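(* Let $G=(A,B,E)$ be a bipartite graph with $n$ vertices, $m=|E|$ edges, and maximum matching $M^*$, whose edges arrive as a stream $\pi$ that is a uniformly random ordering of $E$. Consider the following one-pass algorithm with parameters $\alpha=0.4312$, $\beta=0.7595$: (1) $M_G \gets \mathrm{Greedy}(\pi)$; (2) $M_0\gets \mathrm{Greedy}(\pi[1,\alpha m])$; (3) $F_1\gets$ the set of all pairs $ab$ with $a\in A\setminus A(M_0)$, $b\in B(M_0)$; (4) $M_1\gets \mathrm{Greedy}(F_1\cap \pi(\alpha m,\beta m])$; (5) $A'\gets\{a\in A : \exists b\in B(M_1) \text{ with } ab\in M_0\}$; (6) $F_2\gets$ the set of all pairs $ab$ with $a\in A'$, $b\in B\setminus B(M_0)$; (7) $M_2\gets \mathrm{Greedy}(F_2\cap\pi(\beta m,m])$; (8) $M\gets$ the matching obtained from $M_0$ by augmenting along the paths formed by $M_1\cup M_2$ (for every edge $da\in M_2$, with $ab$ the edge of $M_0$ at $a$ and $bc$ the edge of $M_1$ at $b$, remove $ab$ and add $da$ and $bc$); (9) return the larger of $M_G$ and $M$. Then this is a deterministic one-pass semi-streaming algorithm for maximum bipartite matching that, for every bipartite graph $G$, returns a matching whose expected size (over the uniformly random arrival order) is at least $(\frac12+0.005)|M^*|$, and it can be implemented with $O(1)$ processing time per edge.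
   Context: A $k$-pass semi-streaming algorithm receives the edges of an $n$-vertex graph as a stream, performs at most $k$ passes over the stream, uses memory $O(n\,\mathrm{polylog}\, n)$, and has running time $O(t)$ per edge ($t$ the processing time per letter). $\mathrm{Greedy}(\sigma)$ for a sequence $\sigma$ of edges: start with $M=\emptyset$ and, processing edges in order, add edge $e$ to $M$ whenever $M\cup\{e\}$ is still a matching; output $M$. For a set $F$ of vertex pairs and a stream $\sigma$, $F\cap\sigma$ is the subsequence of $\sigma$ of edges lying in $F$. $\pi[i]$ is the $i$-th edge of $\pi$; for reals $x\le y$, $\pi[x,y]$ is $\pi[\lfloor x\rfloor],\dots,\pi[\lfloor y\rfloor]$ and $\pi(x,y]=\pi[\lfloor x\rfloor+1,\lfloor y\rfloor]$. For a vertex set $S$ and edge set $F$, $S(F)$ is the set of vertices of $S$ covered by $F$. The sets $A,B$ and $m$ are known in advance. *)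

(* Defs.v *)
From mathcomp Require Import all_boot all_order all_algebra.
Set Implicit Arguments.
Unset Strict Implicit.
Unset Printing Implicit Defensive.
Import Order.TTheory GRing.Theory Num.Theory.
Local Open Scope nat_scope.

(** * Bipartite graphs, matchings, and the matching algorithm

    A bipartite graph (A, B, E) is given by two finite types and a set
    [E : {set A * B}]; an edge [e] has endpoints [e.1] in A and [e.2] in B. *)

Section Matching.
Variables A B : finType.
Implicit Types (M F E : {set A * B}) (s pi : seq (A * B)).

Definition is_matching M : bool :=
  [forall e in M, forall f in M,
     (e != f) ==> ((e.1 != f.1) && (e.2 != f.2))].

Definition matching_of E M : bool := (M \subset E) && is_matching M.

Definition maximum_matching_of E M : Prop :=
  matching_of E M /\ forall M', matching_of E M' -> #|M'| <= #|M|.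

Definition greedy s : {set A * B} :=
  foldl (fun M e => if is_matching (e |: M) then e |: M else M) set0 s.

Definition coverA F : {set A} := [set e.1 | e in F].
Definition coverB F : {set B} := [set e.2 | e in F].

Definition restrict F s : seq (A * B) := [seq e <- s | e \in F].

(* Positions are numbered from 1; [Num.truncn] is the floor on nonnegatives. *)
Definition seg pi (i j : nat) : seq (A * B) := drop i.-1 (take j pi).
Definition segcc pi (x y : rat) := seg pi (Num.truncn x) (Num.truncn y).
Definition segoc pi (x y : rat) := seg pi (Num.truncn x).+1 (Num.truncn y).

(* d - a - b - c with d, b in B and a, c in A. *)
Definition aug_path M0 M1 M2 (d : B) (a : A) (b : B) (c : A) : bool :=
  [&& (a, d) \in M2, (a, b) \in M0 & (c, b) \in M1].

Definition augment M0 M1 M2 : {set A * B} :=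
  let removed :=
    [set e | [exists d, exists c, aug_path M0 M1 M2 d e.1 e.2 c]] in
  let added :=
    [set e | [exists b, exists c, aug_path M0 M1 M2 e.2 e.1 b c]] :|:
    [set e | [exists d, exists a, aug_path M0 M1 M2 d a e.2 e.1]] in
  (M0 :\: removed) :|: added.

Definition alpha : rat := (4312%:R / 10000%:R)%R.
Definition beta : rat := (7595%:R / 10000%:R)%R.

Definition random_order_matching (m : nat) pi : {set A * B} :=
  let mr : rat := (m%:R)%R in
  let MG := greedy pi in
  let M0 := greedy (segcc pi 1%R (alpha * mr)%R) in
  let F1 := setX (~: coverA M0) (coverB M0) in
  let M1 := greedy (restrict F1 (segoc pi (alpha * mr)%R (beta * mr)%R)) in
  let A' := [set a | [exists b in coverB M1, (a, b) \in M0]] in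
  let F2 := setX A' (~: coverB M0) in
  let M2 := greedy (restrict F2 (segoc pi (beta * mr)%R mr)) in
  let M := augment M0 M1 M2 in
  if #|MG| < #|M| then M else MG.

Definition ordering_of E pi : bool := perm_eq pi (enum E).

(* [permutations (enum E)] lists each of the #|E|! orderings exactly once. *)
Definition expectation_over_orderings E (X : seq (A * B) -> rat) : rat :=
  ((\sum_(pi <- permutations (enum E)) X pi)
     / (size (permutations (enum E)))%:R)%R.

End Matching.

(** * Semi-streaming algorithms on a word RAM

    The machine has [S] memory cells of [w] bits each and nothing else to
    compute with: there are no registers, all values are reduced modulo 2^w,
    and access to an address >= S is an error (no execution).  The output tape
    is write-only.  *)

Inductive binop := Add | Sub | Mul | Div | Eqb | Ltb.

Inductive expr :=
  | Cst of nat
  | Mem of expr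
  | Bin of binop & expr & expr.

Inductive cmd :=
  | Skip
  | Store of expr & expr
  | Seq of cmd & cmd
  | If of expr & cmd & cmd
  | While of expr & cmd
  | Emit of expr & expr.

Definition binop_fun (o : binop) : nat -> nat -> nat :=
  match o with
  | Add => addn
  | Sub => subn
  | Mul => muln
  | Div => divn
  | Eqb => fun x y => x == y
  | Ltb => fun x y => x < y
  end.

Definition memory := nat -> nat.
Definition upd (w : nat) (mu : memory) (i v : nat) : memory :=
  fun j => if j == i then v %% 2 ^ w else mu j.

Record state := State { mem_of : memory; out_of : seq (nat * nat) }.

Section Semantics.
Variables w S : nat.

Fixpoint eval (mu : memory) (e : expr) : option nat :=
  match e with
  | Cst k => Some (k %% 2 ^ w)
  | Mem e1 =>
      if eval mu e1 is Some i then (if i < S then Some (mu i) else None)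
      else None
  | Bin o e1 e2 =>
      match eval mu e1, eval mu e2 with
      | Some x, Some y => Some (binop_fun o x y %% 2 ^ w)
      | _, _ => None
      end
  end.

Fixpoint cost (e : expr) : nat :=
  match e with
  | Cst _ => 1
  | Mem e1 => (cost e1).+1
  | Bin _ e1 e2 => (cost e1 + cost e2).+1
  end.

(* [exec c st t st']: from [st], [c] halts in [st'] after [t] elementary
   operations. *)
Inductive exec : cmd -> state -> nat -> state -> Prop :=
  | exec_skip st : exec Skip st 1 st
  | exec_store e1 e2 mu out i v :
      eval mu e1 = Some i -> i < S -> eval mu e2 = Some v ->
      exec (Store e1 e2) (State mu out)
           (cost e1 + cost e2).+1 (State (upd w mu i v) out)
  | exec_seq c1 c2 st t1 st1 t2 st2 :
      exec c1 st t1 st1 -> exec c2 st1 t2 st2 ->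
      exec (Seq c1 c2) st (t1 + t2) st2
  | exec_if e c1 c2 st v t st' :
      eval (mem_of st) e = Some v ->
      exec (if v != 0 then c1 else c2) st t st' ->
      exec (If e c1 c2) st (cost e + t).+1 st'
  | exec_while_stop e c st :
      eval (mem_of st) e = Some 0 ->
      exec (While e c) st (cost e).+1 st
  | exec_while_loop e c st v t1 st1 t2 st2 :
      eval (mem_of st) e = Some v -> v != 0 ->
      exec c st t1 st1 -> exec (While e c) st1 t2 st2 ->
      exec (While e c) st (cost e + t1 + t2).+1 st2
  | exec_emit e1 e2 mu out x y :
      eval mu e1 = Some x -> eval mu e2 = Some y ->
      exec (Emit e1 e2) (State mu out)
           (cost e1 + cost e2).+1 (State mu (rcons out (x, y))).

(* An arriving edge is placed in cells 0 and 1. *)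
Definition read_edge (st : state) (e : nat * nat) : state :=
  State (upd w (upd w (mem_of st) 0 e.1) 1 e.2) (out_of st).

(* [pass body t st s st']: one pass over the stream [s], running [body] once
   on each edge in order, each time for at most [t] steps. *)
Inductive pass (body : cmd) (t : nat) :
    state -> seq (nat * nat) -> state -> Prop :=
  | pass_nil st : pass body t st [::] st
  | pass_cons st e s k st1 st2 :
      exec body (read_edge st e) k st1 -> k <= t -> pass body t st1 s st2 ->
      pass body t st (e :: s) st2.

(* The quantities known in advance are |A|, |B| (the two sides being numbered
   from 0) and m, in cells 2, 3 and 4; all other cells are 0. *)
Definition start_state (p q m : nat) : state :=
  State (upd w (upd w (upd w (fun=> 0) 2 p) 3 q) 4 m) [::].

End Semantics.

Record program := Program { init : cmd; body : cmd; finish : cmd }.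

(* One pass over [s]; [tpre], [t] and [tpost] bound the time before the stream,
   for each edge, and after the stream. *)
Definition one_pass_run (w S : nat) (P : program) (p q m tpre t tpost : nat)
    (s out : seq (nat * nat)) : Prop :=
  exists k1 st1 st2 k2 st3,
    [/\ exec w S (init P) (start_state w p q m) k1 st1 /\ k1 <= tpre,
        pass w S (body P) t st1 s st2,
        exec w S (finish P) st2 k2 st3 /\ k2 <= tpost
      & out_of st3 = out].

Definition bitlen (n : nat) : nat := (trunc_log 2 n).+1.

Definition nat_edge (p q : nat) (e : 'I_p * 'I_q) : nat * nat :=
  (nat_of_ord e.1, nat_of_ord e.2).

(* One fixed program computes [alg] on every n-vertex bipartite graph and every
   order of arrival of its edges, in a single pass, with words of O(log n) bits,
   O(n polylog n) words, hence O(n polylog n) bits, of memory, and O(t n)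
   processing time per edge.  What happens outside of the stream takes O(n)
   time, the time needed to write down a matching. *)
Definition one_pass_semi_streaming (t : nat -> nat)
    (alg : forall p q : nat,
       nat -> seq ('I_p * 'I_q) -> {set 'I_p * 'I_q}) : Prop :=
  exists (P : program) (c : nat),
    forall (p q : nat) (E : {set 'I_p * 'I_q}) (pi : seq ('I_p * 'I_q)),
      ordering_of E pi ->
      let n := p + q in
      let w := c * bitlen n in
      let S := c * (n.+1 * bitlen n ^ c) in
      exists out : seq (nat * nat),
        one_pass_run w S P p q #|E| (c * n.+1) (c * t n) (c * n.+1)
          (map (@nat_edge p q) pi) out
        /\ perm_eq out (map (@nat_edge p q) (enum (alg p q #|E| pi))).

(* Main.v *)
Require Import Defs.
From mathcomp Require Import all_boot all_order all_algebra.
From mathcomp Require Import perm zify ring lra.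
Set Implicit Arguments.
Unset Strict Implicit.
Unset Printing Implicit Defensive.
Import Order.TTheory GRing.Theory Num.Theory.
Local Open Scope nat_scope.

(** Write M_t for the greedy matching on the first t edges, i and j for the ends
    of the first two phases, N = |M*|, and suppose E|M_G| < (1/2 + eps) N.

    Exchanging two positions of a random order preserves its law.  Swapping an
    optimal edge that M_t leaves untouched into one of the first t positions makes
    greedy take it; since |M_G| is small, greedy takes at most 2 eps N optimal
    edges on average, so few are untouched at time i and E|M_0| is almost N/2.
    An optimal edge e with exactly one end covered by M_0 has a position that is
    almost independent of its role: e can be moved to position i without changing
    M_0, and then swapped with a later edge, which matters only if greedy accepts
    that edge.  This is rare: the acceptance probability decreases with the
    position, |M_i| - |M_(i/2)| is small, and N/m <= 4 eps because an optimal edge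
    preceding all its neighbours is taken.  Hence M_1 and M_2 see their share of
    the useful optimal edges, of which they pick at least half, and
    E|M_0| + E|M_2| >= (1/2 + eps) N.  The bound N/m <= 4 eps also makes m large
    enough to absorb the rounding of the phase ends. *)

(** The obstacle is that [M_0] depends on the order of the first [i] edges, so an optimal edge with
    a prescribed role is not uniformly placed. What is proved instead is one-sided: the role
    together with position [k] is at most as likely as the role together with position [l] of the
    wanted window, up to a small loss when [k < i]. Averaging over all pairs [(k, l)] then yields
    the share of the window.

    A direct swap of positions [k] and [i.-1] would pull another edge forward and might change
    [M_i]. Hence an edge not taken by [M_i] travels to [i.-1] by adjacent transpositions, each of
    which preserves [M_i], and only the jump across the boundary costs anything. Leaving phase 1
    costs nothing, because eligibility for phase 2 is monotone in [M_1].

    Each of the [N] optimal edges may suffer the loss [i T / (m - i)], with [T] the acceptance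
    probability at the end of the first phase. As [i T] is itself a small multiple of [N], the total
    loss is small compared with [N] only because [N / m] is small. *)

Lemma truncn_mulnat_div (x y m : nat) : 0 < y ->
  Num.truncn ((x%:R / y%:R) * m%:R : rat)%R = (x * m) %/ y.
Proof.
move=> y0; apply: truncn_def; rewrite mulrAC -natrM ler_pdivlMr ?ltr0n //.
by rewrite ltr_pdivrMr ?ltr0n // -!natrM ler_nat ltr_nat leq_trunc_div ltn_ceil.
Qed.

(** The phase ends as integer quotients, which the machine obtains by one multiplication and one
    division. *)
Definition first_cut m := (4312 * m) %/ 10000.
Definition second_cut m := (7595 * m) %/ 10000.

Lemma truncn_alpha m : Num.truncn (alpha * m%:R)%R = first_cut m.
Proof. by rewrite /alpha; apply: truncn_mulnat_div. Qed.

Lemma truncn_beta m : Num.truncn (beta * m%:R)%R = second_cut m.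
Proof. by rewrite /beta; apply: truncn_mulnat_div. Qed.

(** * Greedy matchings *)

Section Greedy.
Variables A B : finType.
Implicit Types (M E : {set A * B}) (e f : A * B) (s : seq (A * B)).

Definition untouched M e := (e.1 \notin coverA M) && (e.2 \notin coverB M).

Lemma is_matchingP M :
  reflect (forall e f, e \in M -> f \in M -> e.1 = f.1 \/ e.2 = f.2 -> e = f)
          (is_matching M).
Proof.
apply: (iffP forall_inP) => [H e f eM fM|H e eM].
  have /forall_inP/(_ _ fM) := H _ eM; case: eqVneq => //= _ /andP[n1 n2].
  by case=> h; [case/eqP: n1 | case/eqP: n2].
apply/forall_inP => f fM; apply/implyP; apply: contraR.
by rewrite negb_and !negbK => /orP[]/eqP h; apply/eqP; apply: H => //; tauto.
Qed.

Lemma coverAP M a : reflect (exists b, (a, b) \in M) (a \in coverA M).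
Proof.
apply: (iffP imsetP) => [[[a' b] h /= ->]|[b h]]; first by exists b.
by exists (a, b).
Qed.

Lemma coverBP M b : reflect (exists a, (a, b) \in M) (b \in coverB M).
Proof.
apply: (iffP imsetP) => [[[a b'] h /= ->]|[a h]]; first by exists a.
by exists (a, b).
Qed.

Lemma mem_coverA M e : e \in M -> e.1 \in coverA M.
Proof. exact: imset_f. Qed.

Lemma mem_coverB M e : e \in M -> e.2 \in coverB M.
Proof. exact: imset_f. Qed.

Lemma coverAS M M' : M \subset M' -> coverA M \subset coverA M'.
Proof. exact: imsetS. Qed.

Lemma coverBS M M' : M \subset M' -> coverB M \subset coverB M'.
Proof. exact: imsetS. Qed.

Lemma card_coverA M : is_matching M -> #|coverA M| = #|M|.
Proof. by move/is_matchingP=> H; rewrite card_in_imset // => e f eM fM h; apply: H => //; left. Qed.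

Lemma card_coverB M : is_matching M -> #|coverB M| = #|M|.
Proof. by move/is_matchingP=> H; rewrite card_in_imset // => e f eM fM h; apply: H => //; right. Qed.

Lemma sub_matching M M' : M \subset M' -> is_matching M' -> is_matching M.
Proof.
move=> /subsetP sMM' /is_matchingP H; apply/is_matchingP => e f /sMM' ? /sMM' ?.
exact: H.
Qed.

Lemma is_matching_setU1 M e :
  is_matching M -> is_matching (e |: M) = (e \in M) || untouched M e.
Proof.
move=> mM; have [eM|eM] := boolP (e \in M); first by rewrite (setUidPr _) ?sub1set.
apply/idP/idP => /=.
  move/is_matchingP=> H; apply/andP; split; apply/imsetP => -[f fM h];
  by move: eM; rewrite (H e f) ?fM ?setU11 ?setU1r //; tauto.
case/andP=> h1 h2; apply/is_matchingP => f g /setU1P[->|fM] /setU1P[->|gM] //.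
- by case=> h; [move: h1|move: h2]; rewrite h ?mem_coverA ?mem_coverB.
- by case=> h; [move: h1|move: h2]; rewrite -h ?mem_coverA ?mem_coverB.
- by move/is_matchingP: mM; apply.
Qed.

Lemma untouchedNin M e : untouched M e -> e \notin M.
Proof. by case/andP=> h _; apply: contra h => /mem_coverA. Qed.

Lemma untouched_sub M M' e : M \subset M' -> untouched M' e -> untouched M e.
Proof.
move=> s /andP[h1 h2]; apply/andP; split.
  by apply: contra h1; apply/subsetP/coverAS.
by apply: contra h2; apply/subsetP/coverBS.
Qed.

Lemma greedy_matching s : is_matching (greedy s).
Proof.
have: is_matching (set0 : {set A * B}) by apply/is_matchingP => e f; rewrite inE.
rewrite /greedy; elim: s set0 => //= e s IH M mM.
by case: ifP => h; apply: IH.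
Qed.

Lemma greedy_rcons s e :
  greedy (rcons s e) = if untouched (greedy s) e then e |: greedy s else greedy s.
Proof.
rewrite {1}/greedy foldl_rcons -/(greedy s) is_matching_setU1 ?greedy_matching //.
have [eM|eM] := boolP (e \in greedy s) => //=.
by case: ifP => // _; apply/setUidPr; rewrite sub1set.
Qed.

Lemma greedy_rcons_sub s e : greedy s \subset greedy (rcons s e).
Proof. by rewrite greedy_rcons; case: ifP => // _; rewrite subsetU1. Qed.

Lemma greedy_cat_sub s s' : greedy s \subset greedy (s ++ s').
Proof.
elim/last_ind: s' => [|s' e IH]; first by rewrite cats0.
by rewrite -rcons_cat (subset_trans IH) ?greedy_rcons_sub.
Qed.

Lemma greedy_take_sub s t t' : t <= t' -> greedy (take t s) \subset greedy (take t' s).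
Proof.
move=> tt'; rewrite -(cat_take_drop t (take t' s)) -take_min (minn_idPl tt').
exact: greedy_cat_sub.
Qed.

Lemma greedy_sub s e : e \in greedy s -> e \in s.
Proof.
elim/last_ind: s => [|s f IH]; first by rewrite inE.
rewrite greedy_rcons mem_rcons inE; case: ifP => _; last by move/IH->; rewrite orbT.
by case/setU1P=> [->|/IH->]; rewrite ?eqxx ?orbT.
Qed.

Lemma greedy_maximal s e : e \in s -> ~~ untouched (greedy s) e.
Proof.
elim/last_ind: s => // s f IH; rewrite mem_rcons inE => /predU1P[->|/IH].
  rewrite greedy_rcons; case: ifP => [_|->] //.
  by rewrite /untouched mem_coverA ?setU11.
by apply: contra; apply: untouched_sub; exact: greedy_rcons_sub.
Qed.

Lemma foldl_greedy s s' :
  greedy (s ++ s') =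
  foldl (fun M e => if is_matching (e |: M) then e |: M else M) (greedy s) s'.
Proof. by rewrite /greedy foldl_cat. Qed.

Lemma greedy_rejected s s' e :
  ~~ untouched (greedy s) e -> greedy (rcons s e ++ s') = greedy (s ++ s').
Proof. by move=> nfe; rewrite !foldl_greedy greedy_rcons (negbTE nfe). Qed.

(** If [e] comes before [f] and is still rejected, then an edge of [s] already blocks it. It is
    rejected after [f] too, and both runs equal the run without [e]. *)
Lemma greedy_swap s s' e f : e \notin greedy (s ++ [:: e, f & s']) ->
  greedy (s ++ [:: f, e & s']) = greedy (s ++ [:: e, f & s']).
Proof.
move=> He; have nfe : ~~ untouched (greedy s) e.
  apply: contra He => fe; rewrite -cat_rcons.
  by apply: (subsetP (greedy_cat_sub _ _)); rewrite greedy_rcons fe setU11.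
rewrite -!cat_rcons.
rewrite [LHS]greedy_rejected; last first.
  by apply: contra nfe; apply: untouched_sub; exact: greedy_rcons_sub.
by rewrite [in RHS]cat_rcons [RHS]greedy_rejected // cat_rcons.
Qed.

(** Each edge of [Ms] has an end among the [2 * #|M|] vertices covered by [M], and distinct edges of
    [Ms] share no end. This is the factor 2 lost in phases 1 and 2. *)
Lemma leq_touched (Ms M : {set A * B}) : is_matching Ms -> is_matching M ->
  (forall e, e \in Ms -> ~~ untouched M e) -> #|Ms| <= 2 * #|M|.
Proof.
move=> mMs mM H; rewrite mul2n -addnn -{1}(card_coverA mM) -(card_coverB mM).
have -> : Ms = [set e in Ms | e.1 \in coverA M] :|: [set e in Ms | e.2 \in coverB M].
  apply/setP=> e; rewrite !inE -andb_orr; case: (boolP (e \in Ms)) => //= /H.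
  by rewrite negb_and !negbK => ->.
apply: leq_trans (leq_card_setU _ _) _; apply: leq_add.
  rewrite -card_coverA; last by apply: sub_matching mMs; apply/subsetP=> e /setIdP[].
  by apply/subset_leq_card/subsetP => a /imsetP[e /setIdP[_ ?] ->].
rewrite -card_coverB; last by apply: sub_matching mMs; apply/subsetP=> e /setIdP[].
by apply/subset_leq_card/subsetP => a /imsetP[e /setIdP[_ ?] ->].
Qed.

(** * Augmentation along paths of length three *)

Section Augment.
Variables M0 M1 M2 : {set A * B}.
Hypotheses (mM0 : is_matching M0) (mM1 : is_matching M1) (mM2 : is_matching M2).
Let A' := [set a | [exists b in coverB M1, (a, b) \in M0]].
Hypothesis sM1 : M1 \subset setX (~: coverA M0) (coverB M0).
Hypothesis sM2 : M2 \subset setX A' (~: coverB M0).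

(** Under [sM2] every edge of [M2] lies on a complete path, so the path conditions in [augment]
    reduce to these incidences; see [augmentE]. *)
Let removed := [set e in M0 | e.1 \in coverA M2].
Let added := [set e in M1 | e.2 \in coverB removed].

Lemma matching_mateB M a b b' : is_matching M -> (a, b) \in M -> (a, b') \in M -> b = b'.
Proof. by move/is_matchingP=> H h h'; have [] := H _ _ h h' (or_introl erefl). Qed.

(** By the choice of [A'] some [M0]-mate of [a] is covered by [M1], and that mate is unique, hence
    equal to [b]. *)
Lemma augment_path a d b : (a, d) \in M2 -> (a, b) \in M0 -> exists c, (c, b) \in M1.
Proof.
move=> h2 h0; have := subsetP sM2 _ h2; rewrite !inE /= => /andP[/exists_inP[b' b'M1 ab'] _].
by move: b'M1; rewrite (matching_mateB mM0 ab' h0) => /coverBP.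
Qed.

Lemma augmentE : augment M0 M1 M2 = (M0 :\: removed) :|: (M2 :|: added).
Proof.
rewrite /augment; congr (_ :|: (_ :|: _)).
- apply/setP=> -[a b]; rewrite !inE /=; case: (boolP ((a, b) \in M0)) => abM0; last by rewrite !andbF.
  rewrite !andbT andTb; congr (~~ _); apply/idP/idP.
    by case/existsP=> d /existsP[c /and3P[? _ _]]; apply/coverAP; exists d.
  case/coverAP=> d h; have [c hc] := augment_path h abM0.
  by apply/existsP; exists d; apply/existsP; exists c; apply/and3P.
- apply/setP=> -[a d]; rewrite inE /=; apply/idP/idP.
    by case/existsP=> b /existsP[c /and3P[]].
  move=> h; have := subsetP sM2 _ h; rewrite !inE /= => /andP[/exists_inP[b _ ab] _].
  have [c hc] := augment_path h ab.
  by apply/existsP; exists b; apply/existsP; exists c; apply/and3P.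
apply/setP=> -[c b]; rewrite !inE /=; apply/idP/idP.
  case/existsP=> d /existsP[a /and3P[? ? ->]] /=; apply/coverBP; exists a.
  by rewrite inE; apply/andP; split=> //; apply/coverAP; exists d.
case/andP=> cb /coverBP[a]; rewrite inE /= => /andP[ab /coverAP[d ad]].
by apply/existsP; exists d; apply/existsP; exists a; apply/and3P.
Qed.

Lemma M2_ends e : e \in M2 -> (e.1 \in coverA M0) /\ (e.2 \notin coverB M0).
Proof.
move=> /(subsetP sM2); rewrite !inE /= => /andP[/exists_inP[b _ h] ->]; split=> //.
by apply/coverAP; exists b.
Qed.

Lemma M1_ends e : e \in M1 -> (e.1 \notin coverA M0) /\ (e.2 \in coverB M0).
Proof. by move=> /(subsetP sM1); rewrite !inE /= => /andP[]. Qed.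

(** [M2] uses B-vertices outside [M0] and [M1] uses A-vertices outside [M0], so these two never
    meet. An edge of [M0] that meets a new edge has been removed. *)
Lemma augment_matching : is_matching (augment M0 M1 M2).
Proof.
rewrite augmentE; apply/is_matchingP.
have mm M : is_matching M -> forall e f, e \in M -> f \in M -> e.1 = f.1 \/ e.2 = f.2 -> e = f.
  by move/is_matchingP.
have H02 e f : e \in M0 :\: removed -> f \in M2 -> e.1 = f.1 \/ e.2 = f.2 -> e = f.
  rewrite !inE => /andP[+ eM0] fM2; rewrite eM0 /= => ne [h|h].
    by move: ne; rewrite h mem_coverA.
  by have [_] := M2_ends fM2; rewrite -h mem_coverB.
have H01 e f : e \in M0 :\: removed -> f \in added -> e.1 = f.1 \/ e.2 = f.2 -> e = f.
  rewrite !inE => /andP[+ eM0] /andP[fM1 fr]; rewrite eM0 /= => ne [h|h].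
    by have [] := M1_ends fM1; rewrite -h mem_coverA.
  case/imsetP: fr => g; rewrite inE => /andP[gM0 g2] h'; move: ne.
  by rewrite (mm _ mM0 e g) ?g2 // h h'; right.
have H21 e f : e \in M2 -> f \in added -> e.1 = f.1 \/ e.2 = f.2 -> e = f.
  rewrite !inE => eM2 /andP[fM1 _]; have [h1 h2] := M2_ends eM2; have [h3 h4] := M1_ends fM1.
  by case=> h; [move: h3; rewrite -h h1 | move: h2; rewrite h h4].
have sw (e f : A * B) : e.1 = f.1 \/ e.2 = f.2 -> f.1 = e.1 \/ f.2 = e.2.
  by case=> ->; tauto.
move=> e f; rewrite 2!in_setU [f \in _]in_setU [f \in _ :|: added]in_setU.
case/or3P=> he /or3P[] hf h.
- by apply: (mm _ mM0) => //; [case/setDP: he|case/setDP: hf].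
- exact: H02.
- exact: H01.
- by apply/esym/H02 => //; exact: sw.
- exact: (mm _ mM2).
- exact: H21.
- by apply/esym/H01 => //; exact: sw.
- by apply/esym/H21 => //; exact: sw.
- by apply: (mm _ mM1) => //; [case/setIdP: he|case/setIdP: hf].
Qed.

Lemma augment_sub E : M0 \subset E -> M1 \subset E -> M2 \subset E ->
  augment M0 M1 M2 \subset E.
Proof.
move=> s0 s1 s2; rewrite augmentE !subUset s2 (subset_trans (subsetDl _ _)) //=.
by apply: subset_trans s1; apply/subsetP => e /setIdP[].
Qed.

(** Each edge of [M2] expels one edge of [M0], which in turn lets in one edge of [M1]: every path
    gains exactly one edge. *)
Lemma card_augment : #|augment M0 M1 M2| = #|M0| + #|M2|.
Proof.
have sr : removed \subset M0 by apply/subsetP=> e /setIdP[].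
have sa : added \subset M1 by apply/subsetP=> e /setIdP[].
have cr : #|removed| = #|M2|.
  rewrite -(card_coverA (sub_matching sr mM0)) -(card_coverA mM2); congr #|pred_of_set _|.
  apply/setP=> a; apply/imsetP/idP => [[e /setIdP[_ ?] ->] //|].
  case/coverAP=> d had; have /coverAP[b hab] := (M2_ends had).1.
  by exists (a, b) => //; rewrite inE hab /=; apply/coverAP; exists d.
have ca : #|added| = #|removed|.
  rewrite -(card_coverB (sub_matching sr mM0)) -(card_coverB (sub_matching sa mM1)).
  congr #|pred_of_set _|; apply/setP=> b; apply/imsetP/idP => [[e /setIdP[_ ?] ->] //|].
  move=> hb; case/coverBP: (hb) => a /setIdP[h0 /coverAP[d h2]].
  have [c hc] := augment_path h2 h0; exists (c, b) => //.
  by rewrite inE hc.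
rewrite augmentE cardsU (_ : _ :&: _ = set0) ?cards0 ?subn0.
  rewrite cardsU (_ : _ :&: _ = set0) ?cards0 ?subn0.
    rewrite cardsD (setIidPr sr) ca cr; have := subset_leq_card sr; rewrite cr; lia.
  apply/setP=> e; rewrite !inE; apply/negbTE/negP => /and3P[/M2_ends[h _] /M1_ends[h' _]].
  by rewrite h in h'.
apply/setP=> e; rewrite !inE; apply/negbTE/negP => /andP[/andP[_ eM0]] /orP[].
  by move/M2_ends=> [_]; rewrite mem_coverB.
by case/andP=> /M1_ends[]; rewrite mem_coverA.
Qed.

End Augment.

(** * The three phases with arbitrary ends *)

Section Phases.
Variables i j : nat.
Implicit Types pi : seq (A * B).

Definition phase0 pi := greedy (take i pi).
Definition phase1 pi :=
  greedy (restrict (setX (~: coverA (phase0 pi)) (coverB (phase0 pi)))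
                   (drop i (take j pi))).
Definition rematchable pi : {set A} :=
  [set a | [exists b in coverB (phase1 pi), (a, b) \in phase0 pi]].
Definition phase2 pi :=
  greedy (restrict (setX (rematchable pi) (~: coverB (phase0 pi))) (drop j pi)).
Definition augmented pi := augment (phase0 pi) (phase1 pi) (phase2 pi).

Lemma greedy_restrict_sub (F : {set A * B}) s : greedy (restrict F s) \subset F.
Proof. by apply/subsetP=> e /greedy_sub; rewrite mem_filter => /andP[]. Qed.

Lemma augmented_matching pi : is_matching (augmented pi).
Proof. by apply: augment_matching; rewrite ?greedy_matching ?greedy_restrict_sub. Qed.

Lemma card_augmented pi : #|augmented pi| = #|phase0 pi| + #|phase2 pi|.
Proof. by apply: card_augment; rewrite ?greedy_matching ?greedy_restrict_sub. Qed.

Lemma augmented_sub pi : augmented pi \subset [set e in pi].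
Proof.
apply: augment_sub; rewrite ?greedy_matching ?greedy_restrict_sub //; apply/subsetP=> e.
- by move/greedy_sub; rewrite inE; apply: mem_take.
- by move/greedy_sub; rewrite inE mem_filter => /andP[_ /mem_drop]; apply: mem_take.
- by move/greedy_sub; rewrite inE mem_filter => /andP[_ /mem_drop].
Qed.

(** Every edge of [phase1] ends at a B-vertex covered by [phase0]; passing to the [phase0]-mate of
    that vertex is a bijection from [phase1] onto the rematchable vertices. *)
Lemma card_rematchable pi : #|rematchable pi| = #|phase1 pi|.
Proof.
have m0 : is_matching (phase0 pi) := greedy_matching _.
pose M' := [set e in phase0 pi | e.2 \in coverB (phase1 pi)].
have mM' : is_matching M' by apply: sub_matching m0; apply/subsetP=> e /setIdP[].
have -> : rematchable pi = coverA M'.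
  apply/setP=> a; rewrite inE; apply/exists_inP/coverAP => -[b].
    by move=> h1 h2; exists b; rewrite inE h2.
  by rewrite inE => /andP[/= h1 h2]; exists b.
rewrite card_coverA // -(card_coverB mM') -card_coverB ?greedy_matching //.
congr #|pred_of_set _|; apply/setP=> b; apply/coverBP/idP => [[a]|h1].
  by rewrite inE => /andP[].
case/coverBP: (h1) => c /greedy_sub; rewrite mem_filter !inE /= => /andP[/andP[_]].
by case/coverBP=> a h0 _; exists a; rewrite inE h0.
Qed.

Lemma rematchable_sub pi : rematchable pi \subset coverA (phase0 pi).
Proof. by apply/subsetP=> a; rewrite inE => /exists_inP[b _ h]; apply/coverAP; exists b. Qed.

End Phases.

Lemma card_setId_sum (M : {set A * B}) (P : pred (A * B)) :
  #|[set e in M | P e]| = \sum_(e in M) P e.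
Proof.
rewrite -sum1_card (eq_bigl (fun e => (e \in M) && P e)) => [|e]; last by rewrite inE.
by rewrite big_mkcondr /=; apply: eq_bigr => e _; case: (P e).
Qed.

(** * Counting optimal edges by the state of their ends *)

Section Counting.
Variables (i j : nat) (Ms : {set A * B}).
Implicit Types pi : seq (A * B).

(** [extends_B] and [extends_A] are membership in the filters of phases 1 and 2. They say nothing
    about where [e] stands in the stream; that is left to the exchange argument. *)
Definition extends_B e pi :=
  (e.1 \notin coverA (phase0 i pi)) && (e.2 \in coverB (phase0 i pi)).

Definition extends_A e pi :=
  (e.1 \in rematchable i j pi) && (e.2 \notin coverB (phase0 i pi)).

Hypothesis mMs : is_matching Ms.

Lemma card_touchedA (M : {set A * B}) :
  is_matching M -> #|[set e in Ms | e.1 \in coverA M]| <= #|M|.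
Proof.
move=> mM; rewrite -card_coverA; last by apply: sub_matching mMs; apply/subsetP=> e /setIdP[].
rewrite -(card_coverA mM).
by apply/subset_leq_card/subsetP => a /imsetP[e /setIdP[_ ?] ->].
Qed.

Lemma card_touchedB (M : {set A * B}) :
  is_matching M -> #|[set e in Ms | e.2 \in coverB M]| <= #|M|.
Proof.
move=> mM; rewrite -card_coverB; last by apply: sub_matching mMs; apply/subsetP=> e /setIdP[].
rewrite -(card_coverB mM).
by apply/subset_leq_card/subsetP => a /imsetP[e /setIdP[_ ?] ->].
Qed.

(** Count the covered ends of optimal edges: two for an edge that is taken, at least one for an edge
    that is touched, none for an untouched one. Each side has at most [#|phase0 t pi|] of them. *)
Lemma card_phase0_lower t pi :
  (#|Ms| + #|[set e in Ms | e \in phase0 t pi]| <=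
   2 * #|phase0 t pi| + #|[set e in Ms | untouched (phase0 t pi) e]|).
Proof.
set M := phase0 t pi; have mM : is_matching M := greedy_matching _.
suff : (#|Ms| + #|[set e in Ms | e \in M]| <= #|[set e in Ms | e.1 \in coverA M]| +
    #|[set e in Ms | e.2 \in coverB M]| + #|[set e in Ms | untouched M e]|)%N.
  by move: (card_touchedA mM) (card_touchedB mM); lia.
rewrite !card_setId_sum -sum1_card -!big_split; apply: leq_sum => e _ /=.
have [eM|_] := boolP (e \in M); first by rewrite mem_coverA // mem_coverB.
by rewrite /untouched; case: (_ \in _); case: (_ \in _).
Qed.

Lemma card_extends_B pi :
  #|Ms| <= #|[set e in Ms | extends_B e pi]| +
    #|[set e in Ms | untouched (phase0 i pi) e]| + #|phase0 i pi|.
Proof.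
have := card_touchedA (greedy_matching (take i pi)); rewrite -/(phase0 i pi).
suff : #|Ms| <= #|[set e in Ms | extends_B e pi]| +
    #|[set e in Ms | untouched (phase0 i pi) e]| +
    #|[set e in Ms | e.1 \in coverA (phase0 i pi)]| by lia.
rewrite !card_setId_sum -sum1_card -!big_split; apply: leq_sum => e _ /=.
by rewrite /extends_B /untouched; case: (_ \in _); case: (_ \in _).
Qed.

(** The rematchable vertices and the A-ends of [S], the optimal edges touched only on the A side,
    both lie in the [#|phase0 i pi|] covered A-vertices. Inclusion-exclusion bounds their
    intersection from below, and each common vertex gives an edge with [extends_A]. *)
Lemma card_extends_A pi :
  #|phase1 i j pi| + #|Ms| <= #|[set e in Ms | extends_A e pi]| +
    2 * #|phase0 i pi| + #|[set e in Ms | untouched (phase0 i pi) e]|.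
Proof.
have m0 : is_matching (phase0 i pi) := greedy_matching _.
have := card_touchedB m0.
pose S := [set e in Ms | (e.1 \in coverA (phase0 i pi)) && (e.2 \notin coverB (phase0 i pi))].
have mS : is_matching S by apply: sub_matching mMs; apply/subsetP=> e /setIdP[].
have cS : #|Ms| <= #|S| + #|[set e in Ms | untouched (phase0 i pi) e]| +
    #|[set e in Ms | e.2 \in coverB (phase0 i pi)]|.
  rewrite !card_setId_sum -sum1_card -!big_split; apply: leq_sum => e _ /=.
  by rewrite /untouched; case: (_ \in _); case: (_ \in _).
have c1 : #|rematchable i j pi :&: coverA S| <= #|[set e in Ms | extends_A e pi]|.
  rewrite -(@card_coverA [set e in Ms | extends_A e pi]); last first.
    by apply: sub_matching mMs; apply/subsetP=> e /setIdP[].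
  apply/subset_leq_card/subsetP => a /setIP[ha /imsetP[e /setIdP[eM /andP[_ e2]] ae]].
  by apply/imsetP; exists e => //; rewrite inE eM /extends_A -ae ha.
have c2 : #|rematchable i j pi :|: coverA S| <= #|phase0 i pi|.
  rewrite -(card_coverA m0) subset_leq_card // subUset rematchable_sub /=.
  by apply/subsetP => a /imsetP[e /setIdP[_ /andP[? _]] ->].
have := cardsUI (rematchable i j pi) (coverA S).
by rewrite card_rematchable card_coverA //; move: cS c1 c2; lia.
Qed.

(** Greedy is maximal on the eligible edges of its window, so [leq_touched] applies. *)
Lemma card_phase1_ge pi :
  #|[set e in Ms | extends_B e pi && (e \in drop i (take j pi))]| <= 2 * #|phase1 i j pi|.
Proof.
apply: leq_touched; rewrite ?greedy_matching //.
  by apply: sub_matching mMs; apply/subsetP=> e /setIdP[].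
move=> e /setIdP[_ /andP[/andP[h1 h2] h]]; apply: greedy_maximal.
by rewrite mem_filter h !inE h1 h2.
Qed.

Lemma card_phase2_ge pi :
  #|[set e in Ms | extends_A e pi && (e \in drop j pi)]| <= 2 * #|phase2 i j pi|.
Proof.
apply: leq_touched; rewrite ?greedy_matching //.
  by apply: sub_matching mMs; apply/subsetP=> e /setIdP[].
move=> [a b] /setIdP[_ /andP[/andP[h1 h2] h]]; apply: greedy_maximal.
by rewrite mem_filter h in_setX in_setC h1 h2.
Qed.

End Counting.

Lemma random_order_matchingE m pi : size pi = m ->
  random_order_matching m pi =
  if #|greedy pi| < #|augmented (first_cut m) (second_cut m) pi|
  then augmented (first_cut m) (second_cut m) pi else greedy pi.
Proof.
move=> sz; rewrite /random_order_matching.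
have := truncn_alpha m; have := truncn_beta m.
generalize alpha beta (first_cut m) (second_cut m) => al be i j ej ei.
rewrite /segcc /segoc /seg ei ej natrK truncn1 drop0.
by rewrite (take_oversize (n := m)) ?sz.
Qed.

Lemma card_random_order_matching m pi : size pi = m ->
  #|random_order_matching m pi| =
  maxn #|greedy pi| #|augmented (first_cut m) (second_cut m) pi|.
Proof. by move/random_order_matchingE->; rewrite /maxn; case: ifP. Qed.

End Greedy.

(** * Exchanging positions of a random order *)

Section SwapPositions.
Variables (T : eqType) (d : T).
Implicit Types (s : seq T).

Definition swapn (x y k : nat) := if k == x then y else if k == y then x else k.

Definition swap_pos x y s := mkseq (fun k => nth d s (swapn x y k)) (size s).

Lemma swapnK x y : involutive (swapn x y).
Proof. by move=> k; rewrite /swapn; do !case: eqP => //; lia. Qed.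

Lemma swapn_lt x y k n : x < n -> y < n -> (swapn x y k < n) = (k < n).
Proof. by rewrite /swapn; do !case: eqP => //; lia. Qed.

Lemma size_swap_pos x y s : size (swap_pos x y s) = size s.
Proof. exact: size_mkseq. Qed.

Lemma nth_swap_pos x y s k : k < size s ->
  nth d (swap_pos x y s) k = nth d s (swapn x y k).
Proof. exact: nth_mkseq. Qed.

Lemma swap_posK x y s : x < size s -> y < size s -> swap_pos x y (swap_pos x y s) = s.
Proof.
move=> xs ys; apply: (@eq_from_nth _ d); rewrite !size_swap_pos // => k ks.
by rewrite !nth_swap_pos ?size_swap_pos ?swapn_lt ?swapnK.
Qed.

Lemma perm_swap_pos x y s : x < size s -> y < size s -> perm_eq (swap_pos x y s) s.
Proof.
move=> xs ys; rewrite -{2}(mkseq_nth d s) /swap_pos /mkseq.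
rewrite (map_comp (nth d s) (swapn x y)); apply: perm_map; apply: uniq_perm.
- by rewrite map_inj_uniq ?iota_uniq //; apply: inv_inj; exact: swapnK.
- exact: iota_uniq.
move=> k; rewrite -{1}(swapnK x y k) mem_map; last by apply: inv_inj; exact: swapnK.
by rewrite !mem_iota !add0n swapn_lt.
Qed.

Lemma take_swap_pos x y s t : t <= x -> t <= y -> take t (swap_pos x y s) = take t s.
Proof.
move=> tx ty; apply: (@eq_from_nth _ d); rewrite !size_take size_swap_pos // => k ks.
have kt : k < t by move: ks; case: ifP; lia.
have ks' : k < size s by move: ks; case: ifP; lia.
by rewrite !nth_take // nth_swap_pos // /swapn; do !case: eqP => //; lia.
Qed.

Lemma seg_swap_pos x y s t t' : (x < t) || (t' <= x) -> (y < t) || (t' <= y) ->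
  drop t (take t' (swap_pos x y s)) = drop t (take t' s).
Proof.
move=> hx hy; apply: (@eq_from_nth _ d); rewrite !size_drop !size_take size_swap_pos // => k ks.
have kt : t + k < t' by move: ks; case: ifP; lia.
have ks' : t + k < size s by move: ks; case: ifP; lia.
by rewrite !nth_drop !nth_take // nth_swap_pos // /swapn; do !case: eqP => //; lia.
Qed.

Lemma swap_pos_adj x s : x.+1 < size s ->
  swap_pos x x.+1 s = take x s ++ [:: nth d s x.+1, nth d s x & drop x.+2 s].
Proof.
move=> xs; apply: (@eq_from_nth _ d).
  by rewrite size_swap_pos size_cat size_takel /= ?size_drop; lia.
rewrite size_swap_pos => k ks; rewrite nth_swap_pos // nth_cat size_takel; last by lia.
rewrite /swapn; case: ltnP => kx; first by rewrite nth_take //; do !case: eqP => //; lia.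
case: eqP => [->|ne]; first by rewrite subnn.
case: eqP => [->|ne']; first by rewrite subSnn.
have -> : k - x = (k - x.+2).+2 by lia.
by rewrite /= nth_drop subnKC //; lia.
Qed.

Lemma seq_split_adj x s : x.+1 < size s ->
  s = take x s ++ [:: nth d s x, nth d s x.+1 & drop x.+2 s].
Proof.
move=> xs; rewrite -{1}(cat_take_drop x s); congr (_ ++ _).
by rewrite (drop_nth d) ?(drop_nth d xs) //; lia.
Qed.

Lemma index_swap_pos x y s e : uniq s -> x < size s -> y < size s ->
  e \in s -> index e s = x -> index e (swap_pos x y s) = y.
Proof.
move=> us xs ys es ix; have -> : e = nth d (swap_pos x y s) y.
  by rewrite nth_swap_pos // /swapn eqxx; case: eqP => [->|_]; rewrite -ix nth_index.
by rewrite index_uniq ?size_swap_pos // (perm_uniq (perm_swap_pos xs ys)).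
Qed.

End SwapPositions.

(** * Expectation and probability over the orderings of [E] *)

Section Orderings.
Variables (A B : finType) (E : {set A * B}).
Local Notation m := #|E|.
Local Notation Ex := (expectation_over_orderings E).
Implicit Types (F G : seq (A * B) -> rat) (Y Z : seq (A * B) -> bool) (pi : seq (A * B)).
Local Open Scope ring_scope.

Definition Pr Y : rat := Ex (fun pi => (Y pi)%:R).

Lemma ordering_size pi : ordering_of E pi -> size pi = m.
Proof. by move/perm_size->; rewrite cardE. Qed.

Lemma ordering_uniq pi : ordering_of E pi -> uniq pi.
Proof. by move/perm_uniq->; rewrite enum_uniq. Qed.

Lemma ordering_mem pi e : ordering_of E pi -> (e \in pi) = (e \in E).
Proof. by move/perm_mem->; rewrite mem_enum. Qed.

Lemma orderings_gt0 : 0 < (size (permutations (enum E)))%:R :> rat.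
Proof. by rewrite ltr0n size_permutations ?enum_uniq ?fact_gt0. Qed.

Lemma Ex_le F G : (forall pi, ordering_of E pi -> F pi <= G pi) -> Ex F <= Ex G.
Proof.
move=> H; rewrite ler_pM2r ?invr_gt0 ?orderings_gt0 // !big_seq.
by apply: ler_sum => pi; rewrite mem_permutations => /H.
Qed.

Lemma Ex_eq F G : (forall pi, ordering_of E pi -> F pi = G pi) -> Ex F = Ex G.
Proof. by move=> H; apply/le_anti/andP; split; apply: Ex_le => pi /H->. Qed.

Lemma ExD F G : Ex (fun pi => F pi + G pi) = Ex F + Ex G.
Proof. by rewrite /expectation_over_orderings big_split mulrDl. Qed.

Lemma ExZ c F : Ex (fun pi => c * F pi) = c * Ex F.
Proof. by rewrite /expectation_over_orderings -mulr_sumr mulrA. Qed.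

Lemma Ex_cst c : Ex (fun=> c) = c.
Proof.
rewrite /expectation_over_orderings big_const_seq count_predT iter_addr_0 -(mulr_natr c) mulfK //.
by rewrite lt0r_neq0 ?orderings_gt0.
Qed.

Lemma Ex_sum I (r : seq I) (P : pred I) (F : I -> seq (A * B) -> rat) :
  Ex (fun pi => \sum_(k <- r | P k) F k pi) = \sum_(k <- r | P k) Ex (F k).
Proof. by rewrite /expectation_over_orderings exchange_big mulr_suml. Qed.

Lemma Ex_involution (f : seq (A * B) -> seq (A * B)) F :
  (forall pi, ordering_of E pi -> ordering_of E (f pi)) ->
  (forall pi, ordering_of E pi -> f (f pi) = pi) ->
  Ex (fun pi => F (f pi)) = Ex F.
Proof.
move=> Hf Kf; rewrite /expectation_over_orderings; congr (_ / _).
rewrite -(big_map f predT F); apply: perm_big; apply: uniq_perm.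
- rewrite map_inj_in_uniq ?permutations_uniq // => p q.
  by rewrite !mem_permutations => hp hq e; rewrite -(Kf p hp) e Kf.
- exact: permutations_uniq.
move=> pi; rewrite mem_permutations; apply/mapP/idP => [[p]|h].
  by rewrite mem_permutations => /Hf + ->.
by exists (f pi); rewrite ?Kf // mem_permutations; apply: Hf.
Qed.

Lemma Pr_le Y Z : (forall pi, ordering_of E pi -> Y pi -> Z pi) -> Pr Y <= Pr Z.
Proof.
move=> H; apply: Ex_le => pi /H; case: (Y pi) => [->//|_]; exact: ler0n.
Qed.

Lemma Pr_ge0 Y : 0 <= Pr Y.
Proof. by rewrite -(Ex_cst 0); apply: Ex_le => pi _; rewrite ler0n. Qed.

Lemma Pr_leD Y Z Z' : (forall pi, ordering_of E pi -> Y pi -> Z pi || Z' pi) ->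
  Pr Y <= Pr Z + Pr Z'.
Proof.
move=> H; rewrite -ExD; apply: Ex_le => pi /H; case: (Y pi) => [/(_ isT)|_].
  by case: (Z pi); case: (Z' pi) => // _; lra.
by rewrite addr_ge0 ?ler0n.
Qed.

(** Swapping two positions is an involution of the orderings, so it maps the event [Y] injectively
    into [Z]. All exchanges of positions below go through this inequality. *)
Lemma Pr_swap d x y Y Z : (x < m)%N -> (y < m)%N ->
  (forall pi, ordering_of E pi -> Y pi -> Z (swap_pos d x y pi)) -> Pr Y <= Pr Z.
Proof.
move=> xm ym H; rewrite /Pr -[in leRHS](@Ex_involution (swap_pos d x y)).
- exact: Pr_le.
- move=> pi hpi; apply: perm_trans (hpi).
  by rewrite perm_swap_pos // (ordering_size hpi).
- by move=> pi hpi; rewrite swap_posK // (ordering_size hpi).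
Qed.

Lemma Ex_card (Ms : {set A * B}) (Y : A * B -> seq (A * B) -> bool) :
  Ex (fun pi => #|[set e in Ms | Y e pi]|%:R) = \sum_(e in Ms) Pr (Y e).
Proof.
rewrite -Ex_sum; apply: Ex_eq => pi _; rewrite -sum1_card natr_sum.
rewrite (eq_bigl (fun e => (e \in Ms) && Y e pi)) => [|e]; last by rewrite inE.
by rewrite big_mkcondr /=; apply: eq_bigr => e _; case: (Y e pi).
Qed.

(** Splits an event by the position of [e], the form in which exchanges can be averaged. *)
Lemma Pr_index Y e x y : e \in E -> (y <= m)%N ->
  \sum_(x <= l < y) Pr (fun pi => Y pi && (index e pi == l)) =
  Pr (fun pi => Y pi && (e \in drop x (take y pi))).
Proof.
move=> eE ym; rewrite -Ex_sum; apply: Ex_eq => pi hpi.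
have es : e \in pi by rewrite (ordering_mem _ hpi).
have -> : (e \in drop x (take y pi)) = (x <= index e pi < y)%N.
  have u := ordering_uniq hpi.
  have := in_take y es; rewrite -{1}(cat_take_drop x (take y pi)) mem_cat.
  have : uniq (take x (take y pi) ++ drop x (take y pi)) by rewrite cat_take_drop take_uniq.
  rewrite cat_uniq -take_min => /and3P[_ /hasPn/(_ e) h _]; rewrite in_take //= in h *.
  case: (boolP (e \in drop _ _)) h => [_ /(_ isT)|_ _]; 
    rewrite ?orbT ?orbF leq_min (leqNgt x); do 2!case: (index e pi < _)%N => //.
have [h|h] := boolP (x <= index e pi < y)%N; last first.
  rewrite big_nat big1 ?andbF // => l hl; case: eqP => [il|]; last by rewrite andbF.
  by move: h; rewrite il hl.
rewrite (bigD1_seq (index e pi)) /= ?mem_index_iota ?iota_uniq // eqxx.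
by rewrite big1 ?addr0 // => l; rewrite eq_sym => /negbTE->; rewrite andbF.
Qed.

Lemma Pr_sum_index Y e : e \in E ->
  \sum_(0 <= l < m) Pr (fun pi => Y pi && (index e pi == l)) = Pr Y.
Proof.
move=> eE; rewrite Pr_index //; apply: Ex_eq => pi hpi.
by rewrite drop0 take_oversize ?(ordering_size hpi) // (ordering_mem _ hpi) eE andbT.
Qed.

(** Termwise domination over all pairs compares the averages over two windows; multiplying out the
    lengths avoids division by an empty window. *)
Lemma sum_cross_le (a b : nat -> rat) x y x' y' :
  (forall k l, (x <= k < y)%N -> (x' <= l < y')%N -> a k <= b l) ->
  (y' - x')%N%:R * \sum_(x <= k < y) a k <= (y - x)%N%:R * \sum_(x' <= l < y') b l.
Proof.
move=> H; rewrite !mulr_natl -sumr_const_nat -sumrMnl !big_nat.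
apply: ler_sum => l hl; rewrite -sumr_const_nat !big_nat.
by apply: ler_sum => k hk; apply: H.
Qed.

End Orderings.

(** * Greedy on a random order *)

Section GreedyProbability.
Variables (A B : finType) (E : {set A * B}) (d : A * B).
Local Notation m := #|E|.
Local Notation Ex := (expectation_over_orderings E).
Local Notation Pr := (Pr E).
Implicit Types (pi : seq (A * B)) (e : A * B).

(** Positions count from 0, so this concerns the edge that arrives after [t] others. *)
Definition accepts t pi := untouched (phase0 t pi) (nth d pi t).

Lemma phase0S t pi : t < size pi ->
  phase0 t.+1 pi = if accepts t pi then nth d pi t |: phase0 t pi else phase0 t pi.
Proof. by move=> ts; rewrite /phase0 (take_nth d ts) greedy_rcons. Qed.

Lemma phase0_sub t t' pi : t <= t' -> phase0 t pi \subset phase0 t' pi.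
Proof. exact: greedy_take_sub. Qed.

Lemma phase0_full t pi : size pi <= t -> phase0 t pi = greedy pi.
Proof. by move=> ?; rewrite /phase0 take_oversize. Qed.

Lemma card_phase0S t pi : t < size pi -> #|phase0 t.+1 pi| = #|phase0 t pi| + accepts t pi.
Proof.
move=> ts; rewrite phase0S //; case: ifP => [/untouchedNin h|_]; last by rewrite addn0.
by rewrite cardsU1 h addnC.
Qed.

Local Open Scope ring_scope.

(** Swap positions [x] and [y]: the first [x] edges stay, and an edge untouched by the longer prefix
    is untouched by the shorter one. *)
Lemma accepts_antimono x y : (x <= y < m)%N -> Pr (accepts y) <= Pr (accepts x).
Proof.
case/andP=> xy ym; apply: (Pr_swap (d := d) ym (leq_ltn_trans xy ym)) => pi hpi.
rewrite /accepts /phase0 take_swap_pos // nth_swap_pos ?(ordering_size hpi); last by lia.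
have -> : swapn y x x = y by rewrite /swapn; case: eqP => //; rewrite eqxx.
exact/untouched_sub/greedy_take_sub.
Qed.

Lemma Ex_card_phase0S t : (t < m)%N ->
  Ex (fun pi => #|phase0 t.+1 pi|%:R) = Ex (fun pi => #|phase0 t pi|%:R) + Pr (accepts t).
Proof.
move=> tm; rewrite -ExD; apply: Ex_eq => pi hpi.
by rewrite card_phase0S ?natrD // (ordering_size hpi).
Qed.

(** The growth of the greedy matching from [u] to [i] is a sum of [i - u] acceptance probabilities,
    the last of which is the smallest. *)
Lemma accepts_le u i : (u <= i <= m)%N ->
  (i - u)%N%:R * Pr (accepts i.-1) <=
  Ex (fun pi => #|phase0 i pi|%:R) - Ex (fun pi => #|phase0 u pi|%:R).
Proof.
case/andP=> ui im.
suff H v : (u <= v <= i)%N -> (v - u)%N%:R * Pr (accepts i.-1) <=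
    Ex (fun pi => #|phase0 v pi|%:R) - Ex (fun pi => #|phase0 u pi|%:R).
  by apply: H; rewrite ui leqnn.
elim: v => [|v IH] /andP[uv vi]; first by rewrite sub0n mul0r (_ : u = 0)%N ?subrr //; lia.
have [->|uv'] := eqVneq u v.+1; first by rewrite subnn mul0r subrr.
have /IH {}IH : (u <= v <= i)%N by lia.
rewrite Ex_card_phase0S ?subSn; try lia.
have : Pr (accepts i.-1) <= Pr (accepts v) by apply: accepts_antimono; lia.
by rewrite -natr1 mulrDl mul1r; move: IH; lra.
Qed.

(** An edge untouched at time [t] stands at some [l >= t]. Swapped to any [k < t], it finds a prefix
    that still leaves it untouched, and greedy takes it. Averaging over the [t] targets and [m - t]
    sources gives the factors. *)
Lemma untouched_phase0_le e t : e \in E -> (t <= m)%N ->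
  t%:R * Pr (fun pi => untouched (phase0 t pi) e) <= (m - t)%N%:R * Pr (fun pi => e \in phase0 t pi).
Proof.
move=> eE tm.
have -> : Pr (fun pi => untouched (phase0 t pi) e) =
    \sum_(t <= l < m) Pr (fun pi => untouched (phase0 t pi) e && (index e pi == l)).
  rewrite Pr_index //; apply: Ex_eq => pi hpi.
  rewrite take_oversize ?(ordering_size hpi) //.
  have es : e \in pi by rewrite (ordering_mem _ hpi).
  move: (es); rewrite -{1}(cat_take_drop t pi) mem_cat => /orP[h|->]; last by rewrite andbT.
  by rewrite (negbTE (greedy_maximal h)).
apply: (@le_trans _ _ ((m - t)%N%:R *
    \sum_(0 <= l < t) Pr (fun pi => (e \in phase0 t pi) && (index e pi == l)))); last first.
  rewrite ler_wpM2l // -(Pr_sum_index (fun pi => e \in phase0 t pi) eE).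
  rewrite [leRHS](@big_cat_nat _ _ _ t) //= lerDl sumr_ge0 // => l _; exact: Pr_ge0.
rewrite -[t in t%:R]subn0; apply: sum_cross_le => l k /andP[tl lm] /andP[_ kt].
have km := leq_trans kt tm.
apply: (Pr_swap (d := d) lm km) => pi hpi /andP[fe /eqP il].
have [sz u] := (ordering_size hpi, ordering_uniq hpi).
have es : e \in pi by rewrite (ordering_mem _ hpi).
have ie := index_swap_pos d u (_ : (l < size pi)%N) (_ : (k < size pi)%N) es il.
rewrite ie ?sz // eqxx andbT; apply: (subsetP (phase0_sub _ kt)).
have ne : nth d (swap_pos d l k pi) k = e.
  rewrite nth_swap_pos ?sz // (_ : swapn l k k = l) -?il ?nth_index //.
  by rewrite /swapn eqxx; case: eqP.
rewrite phase0S ?size_swap_pos ?sz // /accepts ne /phase0 take_swap_pos //; last by lia.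
by rewrite (untouched_sub _ fe) ?setU11 // greedy_take_sub // ltnW.
Qed.

Variable Ms : {set A * B}.
Hypotheses (mMs : is_matching Ms) (sMs : Ms \subset E).

Definition adjacent e := [set f in E | (f.1 == e.1) || (f.2 == e.2)].

(** Here edges are relabelled rather than positions swapped: the transposition of [e] and [f] shows
    that every [f] in [adjacent e] is equally likely to be bounded by [e] as the first of that set
    to arrive. When [e] itself is first, nothing blocks it. *)
Lemma greedy_ge_adjacent e : e \in E ->
  1 <= #|adjacent e|%:R * Pr (fun pi => e \in greedy pi).
Proof.
move=> eE; set D := adjacent e; pose first pi := nth d pi (find (mem D) pi).
have eD : e \in D by rewrite inE eE !eqxx.
have hasD pi : ordering_of E pi -> has (mem D) pi.
  by move=> hpi; apply/hasP; exists e; rewrite ?(ordering_mem _ hpi).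
have Pr_first f : f \in D -> Pr (fun pi => first pi == f) <= Pr (fun pi => first pi == e).
  move=> fD; have fE : f \in E by move: fD; rewrite inE => /andP[].
  have tE x : (tperm e f x \in E) = (x \in E).
    by case: tpermP => [->|->|//]; rewrite eE fE.
  have tD x : (tperm e f x \in D) = (x \in D).
    by case: tpermP => [->|->|//]; rewrite eD fD.
  rewrite [leRHS](_ : _ = Ex (fun pi => (first (map (tperm e f) pi) == e)%:R)); last first.
    rewrite (Ex_involution (fun pi => (first pi == e)%:R)) // => pi hpi.
      apply: uniq_perm; rewrite ?enum_uniq //.
        by rewrite map_inj_uniq ?(ordering_uniq hpi) //; exact: perm_inj.
      move=> x; rewrite -{1}(tpermK e f x) mem_map; last exact: perm_inj.
      by rewrite (ordering_mem _ hpi) mem_enum tE.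
    by rewrite -map_comp map_id_in // => x _ /=; rewrite tpermK.
  apply: Ex_le => pi hpi; rewrite /first find_map.
  rewrite (eq_find (a2 := mem D)) => [|x]; last by rewrite /= tD.
  rewrite (nth_map d) -?has_find ?hasD //.
  by case: eqP => [->|_]; rewrite ?tpermR ?eqxx.
have : 1 <= \sum_(f in D) Pr (fun pi => first pi == f).
  rewrite -Ex_sum -[leLHS](Ex_cst E); apply: Ex_le => pi hpi.
  rewrite (bigD1 (first pi)) /=; last exact: (nth_find d (hasD _ hpi)).
  by rewrite eqxx lerDl sumr_ge0.
move=> /le_trans; apply; apply: (@le_trans _ _ (\sum_(f in D) Pr (fun pi => first pi == e))).
  exact: ler_sum.
rewrite sumr_const -[leLHS]mulr_natl ler_wpM2l //; apply: Pr_le => pi hpi /eqP fe.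
set k := find (mem D) pi; have ks : (k < size pi)%N by rewrite -has_find hasD.
rewrite -(phase0_full (leqnn _)); apply: (subsetP (phase0_sub pi ks)).
have {}fe : nth d pi k = e by [].
rewrite phase0S // /accepts fe; case: ifP => [_|/negbT]; first by rewrite setU11.
have touch g : g \in phase0 k pi -> g.1 = e.1 \/ g.2 = e.2 -> False.
  move=> /greedy_sub gk h; have gD : g \in D.
    by rewrite inE -(ordering_mem _ hpi) (mem_take gk); case: h => ->; rewrite eqxx ?orbT.
  have ik : (index g pi < k)%N by rewrite -(in_take _ (mem_take gk)).
  have := before_find d ik; rewrite nth_index ?(mem_take gk) //=.
  by rewrite gD.
rewrite negb_and !negbK => /orP[]/imsetP[g gk h]; exfalso; apply: (touch g gk); rewrite h; tauto.
Qed.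

(** Conversely, an edge of [E] meets at most one optimal edge at each of its two ends. *)
Lemma sum_adjacent_le : (\sum_(e in Ms) #|adjacent e| <= 2 * m)%N.
Proof.
apply: (@leq_trans (\sum_(e in Ms) (\sum_(f in E) (f.1 == e.1) + \sum_(f in E) (f.2 == e.2)))).
  apply: leq_sum => e _; rewrite card_setId_sum -big_split; apply: leq_sum => f _ /=.
  by case: eqP; case: eqP.
rewrite big_split mul2n -addnn; move/is_matchingP: mMs => H.
apply: leq_add; rewrite exchange_big -sum1_card; apply: leq_sum => f _;
  rewrite -card_setId_sum; apply/card_le1_eqP.
  by move=> x y /setIdP[xM /eqP hx] /setIdP[yM /eqP hy]; apply: H => //; left; rewrite -hx.
by move=> x y /setIdP[xM /eqP hx] /setIdP[yM /eqP hy]; apply: H => //; right; rewrite -hx.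
Qed.

(** The inequality between harmonic and arithmetic means: the probabilities are at least the
    reciprocals of degrees whose sum is at most [2 * m]. *)
Lemma card_greedy_ge :
  #|Ms|%:R ^+ 2 <= 2 * m%:R * \sum_(e in Ms) Pr (fun pi => e \in greedy pi).
Proof.
set N : rat := #|Ms|%:R; set mr : rat := m%:R; have N0 : 0 <= N by rewrite ler0n.
have [m0|] := posnP m.
  have -> : N = 0; last by rewrite expr0n mulr_ge0 ?sumr_ge0 ?mulr_ge0 ?ler0n // => *; exact: Pr_ge0.
  by apply/eqP; rewrite pnatr_eq0 -leqn0 -m0 subset_leq_card.
rewrite -(ltr0n rat) -/mr => m0.
rewrite -(ler_pM2l (_ : 0 < 2 * mr)); last by lra.
(* The tangent to [1 / D] at [D = 2 * mr / N], the mean degree allowed by [sum_adjacent_le], cleared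
   of denominators; its error is the square [(2 * mr - N * D) ^+ 2]. *)
have key e : e \in Ms -> 4 * mr * N - N ^+ 2 * #|adjacent e|%:R <=
    4 * mr ^+ 2 * Pr (fun pi => e \in greedy pi).
  move=> /(subsetP sMs) eE; have := greedy_ge_adjacent eE.
  have : 0 < #|adjacent e|%:R :> rat.
    by rewrite ltr0n card_gt0; apply/set0Pn; exists e; rewrite inE eE eqxx.
  move: (#|adjacent e|%:R) (Pr _) => D p D0 Dp.
  rewrite -subr_ge0 -(pmulr_rge0 _ D0).
  have -> : D * (4 * mr ^+ 2 * p - (4 * mr * N - N ^+ 2 * D)) =
    4 * mr ^+ 2 * (D * p - 1) + (2 * mr - N * D) ^+ 2 by ring.
  by rewrite addr_ge0 ?sqr_ge0 // mulr_ge0 ?subr_ge0 // mulr_ge0 ?sqr_ge0.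
have : \sum_(e in Ms) (4 * mr * N - N ^+ 2 * #|adjacent e|%:R) <=
    \sum_(e in Ms) 4 * mr ^+ 2 * Pr (fun pi => e \in greedy pi) by apply: ler_sum.
rewrite -mulr_sumr sumrB sumr_const -mulr_sumr -natr_sum.
have : (\sum_(e in Ms) #|adjacent e|)%N%:R <= 2 * mr by rewrite -natrM ler_nat sum_adjacent_le.
move: (_%:R) => sD sDle; rewrite -[X in X - _]mulr_natr -/N => H.
have : N ^+ 2 * sD <= N ^+ 2 * (2 * mr) by rewrite ler_wpM2l ?sqr_ge0.
by move: H; set P := \sum_(e in _) _; lra.
Qed.

End GreedyProbability.

(** * Moving an optimal edge between phases *)

Section Exchange.
Variables (A B : finType) (E : {set A * B}) (d : A * B).
Local Notation m := #|E|.
Local Notation Ex := (expectation_over_orderings E).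
Local Notation Pr := (Pr E).
Local Notation swap := (swap_pos d).
Implicit Types (pi : seq (A * B)) (e : A * B) (Y Z : seq (A * B) -> bool).

Lemma phase0_swap_ge t x y pi : t <= x -> t <= y -> phase0 t (swap x y pi) = phase0 t pi.
Proof. by move=> tx ty; rewrite /phase0 take_swap_pos. Qed.

Lemma take_swap_adj t x pi : x.+1 < t -> x.+1 < size pi ->
  take t (swap x x.+1 pi) =
    take x pi ++ [:: nth d pi x.+1, nth d pi x & take (t - x.+2) (drop x.+2 pi)]
  /\ take t pi =
    take x pi ++ [:: nth d pi x, nth d pi x.+1 & take (t - x.+2) (drop x.+2 pi)].
Proof.
move=> xt xs; have sx : size (take x pi) = x by rewrite size_takel //; lia.
have tx : t - x = (t - x.+2).+2 by lia.
have ntx : (t < x) = false by lia.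
split; first by rewrite swap_pos_adj // take_cat sx ntx tx.
by rewrite {1}(seq_split_adj d xs) take_cat sx ntx tx.
Qed.

Lemma phase0_swap_adj t x e pi : x.+1 < t -> x.+1 < size pi -> nth d pi x = e ->
  e \notin phase0 t pi -> phase0 t (swap x x.+1 pi) = phase0 t pi.
Proof.
move=> xt xs <-; rewrite /phase0; have [-> ->] := take_swap_adj xt xs.
exact: greedy_swap.
Qed.

(** The rejected edge [e] occupies the last slot of the prefix, so replacing it can change the
    matching only if the newcomer is accepted. *)
Lemma phase0_swap_last t y e pi : 0 < t -> t <= y < size pi -> nth d pi t.-1 = e ->
  e \notin phase0 t pi ->
  accepts d t.-1 (swap t.-1 y pi) || (phase0 t (swap t.-1 y pi) == phase0 t pi).
Proof.
case: t => // t _ /andP[ty ys] /= et; have ts : t < size pi by lia.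
rewrite !(phase0S d) ?size_swap_pos //; case: (boolP (accepts d t pi)) => [h|_ _].
  by rewrite et setU11.
by case: (accepts d t (swap t y pi)); rewrite //= phase0_swap_ge ?eqxx //; lia.
Qed.

Local Open Scope ring_scope.

Lemma Pr_move Y Z e x y : e \in E -> (x < m)%N -> (y < m)%N ->
  (forall pi, ordering_of E pi -> index e pi = x -> nth d pi x = e -> Y pi -> Z (swap x y pi)) ->
  Pr (fun pi => Y pi && (index e pi == x)) <= Pr (fun pi => Z pi && (index e pi == y)).
Proof.
move=> eE xm ym H; apply: (Pr_swap (d := d) xm ym) => pi hpi /andP[hY /eqP ix].
have [sz u] := (ordering_size hpi, ordering_uniq hpi).
have es : e \in pi by rewrite (ordering_mem _ hpi).
by rewrite (index_swap_pos d u) ?sz // eqxx H // -ix nth_index.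
Qed.

(** Acceptance at [i.-1] ignores the order of the later edges, so the [m - i] positions from [i] on
    are equally likely for [e]. *)
Lemma Pr_accepts_index e i l : e \in E -> (i <= l < m)%N -> (0 < i)%N ->
  (m - i)%N%:R * Pr (fun pi => accepts d i.-1 pi && (index e pi == l)) <= Pr (accepts d i.-1).
Proof.
move=> eE /andP[il lm] i0.
apply: (@le_trans _ _ (\sum_(i <= k < m) Pr (fun pi => accepts d i.-1 pi && (index e pi == k)))).
  have /(sum_cross_le (a := fun l => Pr (fun pi => accepts d i.-1 pi && (index e pi == l)))) :
    forall k k', (l <= k < l.+1)%N -> (i <= k' < m)%N ->
    Pr (fun pi => accepts d i.-1 pi && (index e pi == k)) <=
    Pr (fun pi => accepts d i.-1 pi && (index e pi == k')).
    move=> k k' hk /andP[ik km]; apply: Pr_move => //; first by lia.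
    move=> pi hpi _ _; rewrite /accepts phase0_swap_ge; try lia.
    rewrite nth_swap_pos ?(ordering_size hpi); last by lia.
    by have -> : swapn k k' i.-1 = i.-1 by rewrite /swapn; do !case: eqP => //; lia.
  by rewrite big_nat1 subSnn mul1r.
by rewrite Pr_index //; apply: Pr_le => pi _ /andP[].
Qed.

(** [sum_cross_le] with an extra loss [r] for each of the [i] early positions. *)
Lemma sum_exchange (a : nat -> rat) (r : rat) x y i n : (i <= n)%N ->
  (forall k l, (k < n)%N -> (x <= l < y)%N -> a k <= a l + (k < i)%N%:R * r) ->
  (y - x)%N%:R * \sum_(0 <= k < n) a k <=
  n%:R * \sum_(x <= l < y) a l + (y - x)%N%:R * (i%:R * r).
Proof.
move=> im H.
have := @sum_cross_le (fun k => a k - (k < i)%N%:R * r) a 0 n x y.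
rewrite subn0 sumrB -mulr_suml.
have -> : \sum_(0 <= k < n) (k < i)%N%:R = i%:R :> rat.
  rewrite (@big_cat_nat _ _ _ i) //= [X in _ + X]big_nat [X in _ + X]big1 => [|k /andP[ik _]].
    rewrite addr0 big_nat (eq_bigr (fun=> 1)) => [|k /andP[_ ->] //].
    by rewrite -big_nat sumr_const_nat subn0.
  by rewrite ltnNge ik.
move=> H'; rewrite -lerBlDr -mulrBr; apply: H' => k l kn hl.
by rewrite lerBlDr H //; case/andP: kn.
Qed.

Section Early.
Variables (i j : nat) (e : A * B) (Y Z : seq (A * B) -> bool).
Hypotheses (eE : e \in E) (i0 : (0 < i)%N) (ij : (i <= j)%N).
Hypothesis Y_ext : forall pi pi', phase0 i pi = phase0 i pi' ->
  drop i (take j pi) = drop i (take j pi') -> Y pi -> Y pi'.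
Hypothesis Y_out : forall pi, Y pi -> e \notin phase0 i pi.

(** Since [Y] excludes [e] from the matching, each adjacent step to the right preserves [phase0 i]
    by [greedy_swap], and the window from [i] to [j] is out of reach. *)
Lemma Pr_move_early l : (l < i <= m)%N ->
  Pr (fun pi => Y pi && (index e pi == l)) <= Pr (fun pi => Y pi && (index e pi == i.-1)).
Proof.
case/andP=> li im; have [n ln] : exists n, (l + n = i.-1)%N by exists (i.-1 - l)%N; lia.
elim: n l li ln => [|n IH] l li ln; first by rewrite -ln addn0.
apply: le_trans (IH l.+1 _ _); try lia.
apply: Pr_move => //; try lia.
move=> pi hpi _ nl hY; apply: Y_ext (hY); last by rewrite seg_swap_pos //; lia.
by rewrite (phase0_swap_adj _ _ nl (Y_out hY)) ?(ordering_size hpi) //; lia.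
Qed.

Lemma Pr_move_late l k : (l < i)%N -> (j <= k < m)%N ->
  Pr (fun pi => Y pi && (index e pi == l)) <=
  Pr (fun pi => Y pi && (index e pi == k)) + Pr (accepts d i.-1) / (m - i)%N%:R.
Proof.
move=> li /andP[jk km]; apply: le_trans (Pr_move_early _) _; first by lia.
(* After the swap either the edge now at [i.-1] is accepted, or [phase0 i] is unchanged and [Y]
   survives. *)
apply: (@le_trans _ _ (Pr (fun pi => (Y pi || accepts d i.-1 pi) && (index e pi == k)))).
  apply: Pr_move => //; first by lia.
  move=> pi hpi _ ne hY; have := phase0_swap_last (y := k) i0 _ ne (Y_out hY).
  rewrite (ordering_size hpi) => /(_ _)/orP[|->|/eqP eq0]; rewrite ?orbT //; first by lia.
  by apply/orP; left; apply: Y_ext hY => //; rewrite seg_swap_pos //; lia.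
apply: (@le_trans _ _ (Pr (fun pi => Y pi && (index e pi == k)) +
    Pr (fun pi => accepts d i.-1 pi && (index e pi == k)))).
  by apply: Pr_leD => pi _; rewrite andb_orl.
rewrite lerD2l ler_pdivlMr ?ltr0n ?subn_gt0; last by lia.
by rewrite mulrC Pr_accepts_index //; lia.
Qed.

End Early.

End Exchange.

(** * Where the edges eligible for phases 1 and 2 stand *)

Section Augmentations.
Variables (A B : finType) (E : {set A * B}) (d : A * B) (i j : nat).
Local Notation m := #|E|.
Local Notation Ex := (expectation_over_orderings E).
Local Notation Pr := (Pr E).
Local Notation swap := (swap_pos d).
Implicit Types (pi : seq (A * B)) (e : A * B).
Hypotheses (i0 : 0 < i) (ij : i <= j) (jm : j <= m).

Lemma phase1_ext pi pi' : phase0 i pi = phase0 i pi' ->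
  drop i (take j pi) = drop i (take j pi') -> phase1 i j pi = phase1 i j pi'.
Proof. by rewrite /phase1 => -> ->. Qed.

Lemma extends_A_sub e pi pi' : phase0 i pi = phase0 i pi' ->
  phase1 i j pi \subset phase1 i j pi' -> extends_A i j e pi -> extends_A i j e pi'.
Proof.
move=> e0 s1 /andP[h1 h2]; apply/andP; rewrite -e0; split=> //.
move: h1; rewrite !inE => /exists_inP[b b1 h0]; apply/exists_inP; exists b; last by rewrite -e0.
exact: (subsetP (coverBS s1)).
Qed.

(** The A-end is matched by [phase0], whereas phase 1 asks for a free one: phase 1 ignores such an
    edge wherever it stands. *)
Lemma extends_A_edge e pi : extends_A i j e pi ->
  e \notin setX (~: coverA (phase0 i pi)) (coverB (phase0 i pi)).
Proof. by case/andP=> /(subsetP (rematchable_sub _ _ _)) h _; rewrite !inE h. Qed.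

Lemma extends_A_swap_adj e x pi : i <= x -> x.+1 < j -> j <= size pi -> nth d pi x = e ->
  extends_A i j e pi -> extends_A i j e (swap x x.+1 pi).
Proof.
move=> ix xj js ne h; have e0 : phase0 i (swap x x.+1 pi) = phase0 i pi.
  by rewrite phase0_swap_ge //; lia.
apply: extends_A_sub (h) => //; rewrite /phase1 e0.
have [-> ->] := @take_swap_adj _ _ d j x pi xj (leq_trans xj js).
rewrite !drop_cat size_takel; last by lia.
rewrite /restrict; case: ltnP => [_|xi].
  by rewrite !filter_cat /= ne (negbTE (extends_A_edge h)).
have -> : i - x = 0 by lia.
by rewrite !drop0 /= ne (negbTE (extends_A_edge h)).
Qed.

(** The ignored edge leaves the last slot of phase 1, and the edge replacing it is the last one read
    there, so it can only enlarge [phase1]. This is why leaving phase 1 costs nothing. *)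
Lemma extends_A_swap_last e k pi : i < j -> j <= k < size pi -> nth d pi j.-1 = e ->
  extends_A i j e pi -> extends_A i j e (swap j.-1 k pi).
Proof.
move=> lij /andP[jk ks] ne h; have e0 : phase0 i (swap j.-1 k pi) = phase0 i pi.
  by rewrite phase0_swap_ge //; lia.
apply: extends_A_sub (h) => //; rewrite /phase1 e0.
have js : j.-1 < size pi by lia.
have -> : take j pi = rcons (take j.-1 pi) e by rewrite -ne -take_nth // prednK //; lia.
have -> : take j (swap j.-1 k pi) = rcons (take j.-1 pi) (nth d (swap j.-1 k pi) j.-1).
  rewrite -[X in rcons X](@take_swap_pos _ d j.-1 k) //; last by lia.
  by rewrite -take_nth ?size_swap_pos // prednK //; lia.
have ij1 : i <= size (take j.-1 pi) by rewrite size_takel; lia.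
rewrite !drop_rcons // /restrict !filter_rcons (negbTE (extends_A_edge h)).
by case: ifP => // _; exact: greedy_rcons_sub.
Qed.

Local Open Scope ring_scope.

Local Notation loss := (i%:R * (Pr (accepts d i.-1) / (m - i)%N%:R)).

Lemma Pr_extends_B_window e : e \in E ->
  (j - i)%N%:R * Pr (extends_B i e) <=
  m%:R * Pr (fun pi => extends_B i e pi && (e \in drop i (take j pi))) + (j - i)%N%:R * loss.
Proof.
move=> eE; rewrite -(Pr_sum_index (extends_B i e) eE) -(Pr_index _ _ eE jm).
apply: sum_exchange; first by lia.
move=> k l km hl; have [ki|ik] := ltnP k i.
  (* [extends_B] depends on [phase0] alone, so the protected window is empty and any position from
     [i] on may be the target. *)
  rewrite mul1r; apply: (@Pr_move_late _ _ _ _ i i) => //; try lia.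
    by move=> pi pi' e0 _; rewrite /extends_B e0.
  by move=> pi /andP[+ _]; apply: contra => /mem_coverA.
rewrite mul0r addr0; apply: (@Pr_move _ _ _ d) => //; first by lia.
by move=> pi hpi _ _; rewrite /extends_B phase0_swap_ge //; lia.
Qed.

(** From inside phase 1 the edge moves by adjacent steps to [j.-1] and then jumps out; from phase 2
    a single swap leaves both earlier phases as they are. *)
Lemma Pr_extends_A_late e k l : e \in E -> (i <= k < m)%N -> (j <= l < m)%N ->
  Pr (fun pi => extends_A i j e pi && (index e pi == k)) <=
  Pr (fun pi => extends_A i j e pi && (index e pi == l)).
Proof.
move=> eE /andP[ik km] /andP[jl lm]; have [kj|jk] := ltnP k j; last first.
  apply: (@Pr_move _ _ _ d) => // pi hpi _ _; apply: extends_A_sub.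
    by rewrite phase0_swap_ge //; lia.
  have e0 : phase0 i (swap k l pi) = phase0 i pi by rewrite phase0_swap_ge //; lia.
  by rewrite (phase1_ext e0) // seg_swap_pos // ?jk ?jl orbT.
apply: (@le_trans _ _ (Pr (fun pi => extends_A i j e pi && (index e pi == j.-1)))); last first.
  apply: (@Pr_move _ _ _ d) => //; first by lia.
  by move=> pi hpi _ ne; apply: extends_A_swap_last; rewrite // ?(ordering_size hpi); lia.
have [n kn] : exists n, (k + n = j.-1)%N by exists (j.-1 - k)%N; lia.
elim: n k ik km kj kn => [|n IH] k ik km kj kn; first by rewrite -kn addn0.
apply: le_trans (IH k.+1 _ _ _ _); try lia.
apply: (@Pr_move _ _ _ d) => //; first by lia.
by move=> pi hpi _ ne; apply: extends_A_swap_adj; rewrite // ?(ordering_size hpi); lia.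
Qed.

Lemma Pr_extends_A_window e : e \in E ->
  (m - j)%N%:R * Pr (extends_A i j e) <=
  m%:R * Pr (fun pi => extends_A i j e pi && (e \in drop j pi)) + (m - j)%N%:R * loss.
Proof.
move=> eE; rewrite -(Pr_sum_index (extends_A i j e) eE).
have -> : Pr (fun pi => extends_A i j e pi && (e \in drop j pi)) =
    Pr (fun pi => extends_A i j e pi && (e \in drop j (take m pi))).
  by apply: Ex_eq => pi hpi; rewrite take_oversize // (ordering_size hpi).
rewrite -(Pr_index _ _ eE (leqnn m)).
apply: sum_exchange; first by lia.
move=> k l km hl; have [ki|ik] := ltnP k i.
  (* Here the edges of phase 1 must stay in place, so the jump goes directly to a target beyond
     [j]. *)
  rewrite mul1r; apply: (@Pr_move_late _ _ _ _ i j) => //; try lia.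
    move=> pi pi' e0 e1; apply: extends_A_sub => //.
    by rewrite (phase1_ext e0).
  by move=> pi /andP[_]; apply: contra => /mem_coverB.
rewrite mul0r addr0; apply: Pr_extends_A_late => //; by rewrite ik.
Qed.

End Augmentations.

(** * The approximation ratio *)

Section Expectation.
Variables (A B : finType) (E Ms : {set A * B}).
Hypotheses (mMs : is_matching Ms) (sMs : Ms \subset E).
Local Notation m := #|E|.
Local Notation Ex := (expectation_over_orderings E).
Local Notation Pr := (Pr E).
Implicit Types (pi : seq (A * B)) (e : A * B).
Local Open Scope ring_scope.

Lemma Ex_phase0_lower t :
  #|Ms|%:R + \sum_(e in Ms) Pr (fun pi => e \in phase0 t pi) <=
  2 * Ex (fun pi => #|phase0 t pi|%:R) + \sum_(e in Ms) Pr (fun pi => untouched (phase0 t pi) e).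
Proof.
rewrite -!Ex_card -[X in X + _ <= _](Ex_cst E) -ExZ -!ExD; apply: Ex_le => pi _.
by rewrite -natrM -!natrD ler_nat card_phase0_lower.
Qed.

Lemma sum_untouched_le (d : A * B) t : (t <= m)%N ->
  t%:R * \sum_(e in Ms) Pr (fun pi => untouched (phase0 t pi) e) <=
  (m - t)%N%:R * \sum_(e in Ms) Pr (fun pi => e \in phase0 t pi).
Proof.
move=> tm; rewrite !mulr_sumr; apply: ler_sum => e /(subsetP sMs) eE.
exact: untouched_phase0_le.
Qed.

Lemma sum_phase0_le t :
  \sum_(e in Ms) Pr (fun pi => e \in phase0 t pi) <= \sum_(e in Ms) Pr (fun pi => e \in greedy pi).
Proof.
apply: ler_sum => e _; apply: Pr_le => pi _; apply/subsetP.
by rewrite -{2}(cat_take_drop t pi); exact: greedy_cat_sub.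
Qed.

Lemma Ex_greedy_lower :
  #|Ms|%:R + \sum_(e in Ms) Pr (fun pi => e \in greedy pi) <= 2 * Ex (fun pi => #|greedy pi|%:R).
Proof.
have eqm pi : ordering_of E pi -> phase0 m pi = greedy pi.
  by move=> hpi; rewrite phase0_full // (ordering_size hpi).
have := Ex_phase0_lower m.
have -> : \sum_(e in Ms) Pr (fun pi => untouched (phase0 m pi) e) = 0.
  apply: big1 => e /(subsetP sMs) eE; rewrite -[RHS](Ex_cst E); apply: Ex_eq => pi hpi.
  by rewrite eqm // (negbTE (greedy_maximal _)) // (ordering_mem _ hpi).
rewrite addr0 (eq_bigr (fun e => Pr (fun pi => e \in greedy pi))) => [|e _]; last first.
  by apply: Ex_eq => pi hpi; rewrite eqm.
by rewrite (Ex_eq (G := fun pi => #|greedy pi|%:R)) // => pi hpi; rewrite eqm.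
Qed.

Lemma Ex_phase0_le t : Ex (fun pi => #|phase0 t pi|%:R) <= Ex (fun pi => #|greedy pi|%:R).
Proof.
apply: Ex_le => pi _; rewrite ler_nat subset_leq_card //.
by rewrite -{2}(cat_take_drop t pi); exact: greedy_cat_sub.
Qed.

Section Phases.
Variables (d : A * B) (i j : nat).
Hypotheses (i0 : (0 < i)%N) (ij : (i <= j)%N) (jm : (j <= m)%N).

Local Notation loss1 := (i%:R * (Pr (accepts d i.-1) / (m - i)%N%:R)).
Local Notation loss := (#|Ms|%:R * loss1).
Local Notation mu0 := (Ex (fun pi => #|phase0 i pi|%:R)).
Local Notation unt := (\sum_(e in Ms) Pr (fun pi => untouched (phase0 i pi) e)).

Lemma Ex_phase1_ge :
  (j - i)%N%:R * (#|Ms|%:R - unt - mu0 - loss) <= m%:R * (2 * Ex (fun pi => #|phase1 i j pi|%:R)).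
Proof.
pose b := \sum_(e in Ms) Pr (fun pi => extends_B i e pi && (e \in drop i (take j pi))).
have hb : b <= 2 * Ex (fun pi => #|phase1 i j pi|%:R).
  rewrite /b -Ex_card -ExZ; apply: Ex_le => pi _.
  by rewrite -natrM ler_nat card_phase1_ge.
have ha : #|Ms|%:R <= \sum_(e in Ms) Pr (extends_B i e) + unt + mu0.
  rewrite -!Ex_card -!ExD -[leLHS](Ex_cst E); apply: Ex_le => pi _.
  by rewrite -!natrD ler_nat card_extends_B.
have hw : (j - i)%N%:R * \sum_(e in Ms) Pr (extends_B i e) <= m%:R * b + (j - i)%N%:R * loss.
  rewrite /b (_ : loss = \sum_(e in Ms) loss1); last by rewrite sumr_const mulr_natl.
  rewrite !mulr_sumr -big_split.
  by apply: ler_sum => e /(subsetP sMs) eE; exact: Pr_extends_B_window.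
apply: le_trans (ler_wpM2l (ler0n _ _) hb); rewrite mulrBr lerBlDr.
by apply: le_trans hw; rewrite ler_wpM2l //; lra.
Qed.

Lemma Ex_phase2_ge :
  (m - j)%N%:R * (Ex (fun pi => #|phase1 i j pi|%:R) + #|Ms|%:R - 2 * mu0 - unt - loss) <=
  m%:R * (2 * Ex (fun pi => #|phase2 i j pi|%:R)).
Proof.
pose b := \sum_(e in Ms) Pr (fun pi => extends_A i j e pi && (e \in drop j pi)).
have hb : b <= 2 * Ex (fun pi => #|phase2 i j pi|%:R).
  rewrite /b -Ex_card -ExZ; apply: Ex_le => pi _.
  by rewrite -natrM ler_nat card_phase2_ge.
have ha : Ex (fun pi => #|phase1 i j pi|%:R) + #|Ms|%:R <=
    \sum_(e in Ms) Pr (extends_A i j e) + 2 * mu0 + unt.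
  rewrite -!Ex_card -[#|Ms|%:R](Ex_cst E) -ExZ -!ExD; apply: Ex_le => pi _.
  by rewrite -natrM -!natrD ler_nat card_extends_A.
have hw : (m - j)%N%:R * \sum_(e in Ms) Pr (extends_A i j e) <= m%:R * b + (m - j)%N%:R * loss.
  rewrite /b (_ : loss = \sum_(e in Ms) loss1); last by rewrite sumr_const mulr_natl.
  rewrite !mulr_sumr -big_split.
  by apply: ler_sum => e /(subsetP sMs) eE; exact: Pr_extends_A_window.
apply: le_trans (ler_wpM2l (ler0n _ _) hb); rewrite mulrBr lerBlDr.
by apply: le_trans hw; rewrite ler_wpM2l //; lra.
Qed.

End Phases.

Lemma Ex_augmented :
  forall i j, Ex (fun pi => #|augmented i j pi|%:R) =
  Ex (fun pi => #|phase0 i pi|%:R) + Ex (fun pi => #|phase2 i j pi|%:R).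
Proof. by move=> i j; rewrite -ExD; apply: Ex_eq => pi _; rewrite card_augmented natrD. Qed.

End Expectation.

(** * Numerical estimates *)

Section Arithmetic.
Local Open Scope ring_scope.

(** The case where greedy alone fails, with excess [1 / 200]: doubling it bounds the optimal edges
    taken by [N / 100], and doubling once more bounds the density by [1 / 50]. *)
Lemma matching_density_bound (R : realFieldType) (N mr Pm G : R) : 0 < N -> N ^+ 2 <= 2 * mr * Pm ->
  N + Pm <= 2 * G -> G < 101 / 200 * N -> 0 <= mr -> Pm <= N / 100 /\ 50 * N <= mr.
Proof.
move=> N0 h1 h2 h3 m0; have hP : Pm <= N / 100 by lra.
split=> //; rewrite -(ler_pM2l N0).
have : 2 * mr * Pm <= 2 * mr * (N / 100) by rewrite ler_wpM2l //; lra.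
by move: h1; rewrite expr2; lra.
Qed.

Lemma ratio_bound (R : realFieldType) (t x y mr c : R) : 0 < t -> t * x <= (mr - t) * y -> 0 <= y ->
  mr - t <= c * t -> x <= c * y.
Proof.
move=> t0 h y0 hc; rewrite -(ler_pM2l t0); apply: le_trans h _.
by rewrite mulrA ler_wpM2r // [t * c]mulrC.
Qed.

(* All quantities are expectations: [x], [y] count the optimal edges left
   untouched, resp. taken by the first phase, [xu], [yu] by its first half [u];
   [T] is the probability that the last edge of the first phase is accepted. *)
Lemma ratio_arithmetic (R : realFieldType)
    (N mr G y x mu yu xu muu T i j u M1 M2 mi mj mu' ji iu : R) :
  mi = mr - i -> mj = mr - j -> mu' = mr - u -> ji = j - i -> iu = i - u ->
  0 < N -> 1 <= N -> 50 * N <= mr -> G < 101 / 200 * N ->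
  (43 * 100 + 12) / (100 * 100) * mr - 1 <= i <= (43 * 100 + 12) / (100 * 100) * mr ->
  (75 * 100 + 95) / (100 * 100) * mr - 1 <= j <= (75 * 100 + 95) / (100 * 100) * mr ->
  u * 2 <= i -> i <= u * 2 + 1 ->
  0 <= y <= N / 100 -> 0 <= yu <= N / 100 ->
  N + y <= 2 * mu + x -> N + yu <= 2 * muu + xu -> mu <= G ->
  i * x <= mi * y -> u * xu <= mu' * yu ->
  0 <= T -> iu * T <= mu - muu ->
  ji * (N - x - mu - N * (i * (T / mi))) <= mr * (2 * M1) ->
  mj * (M1 + N - 2 * mu - x - N * (i * (T / mi))) <= mr * (2 * M2) ->
  101 / 200 * N <= mu + M2.
Proof.
move=> -> -> -> -> -> N0 N1 Nm HG /andP[i1 i2] /andP[j1 j2] u1 u2 /andP[y0 y1] /andP[yu0 yu1].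
move=> hmu hmuu muG hx hxu T0 hT h1 h2.
have mr50 : 50 <= mr by lra.
(* Rounding costs at most 1, hence at most [mr / 50], so [i >= 0.4112 * mr], and 0.5888 / 0.4112 <
   36 / 25. *)
have x1 : x <= 36 / 25 * y by apply: (ratio_bound (t := i) (mr := mr)) => //; lra.
(* Halving [i] costs a further rounding: [u >= 0.1956 * mr], and 0.8044 / 0.1956 < 103 / 25. *)
have xu1 : xu <= 103 / 25 * yu by apply: (ratio_bound (t := u) (mr := mr)) => //; lra.
(* As [u] is at most half of [i], [i * T] is at most twice the growth [mu - muu]. Here
   [mu < 0.505 * N] and [muu >= 0.4844 * N]. *)
have iT : i * T <= 42 / (10 * 100) * N.
  have : i * T <= 2 * ((i - u) * T) by rewrite mulrA ler_wpM2r //; lra.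
  lra.
have mi0 : 0 < mr - i by lra.
(* [mr - i >= 0.5688 * mr >= 28.44 * N], and 0.042 / 28.44 < 0.0015. *)
have L : N * (i * (T / (mr - i))) <= 15 / (100 * 100) * N.
  rewrite [leRHS]mulrC ler_wpM2l //; first by lra.
  rewrite mulrA ler_pdivrMr //; apply: le_trans iT _; lra.
move: (N * (i * (T / (mr - i)))) L h1 h2 => L hL h1 h2.
(* The window has relative length at least 0.7595 - 0.4312 - 0.02 = 0.3083. For phase 2 below,
   rounding [j] down only helps, and 1 - 0.7595 = 0.2405. *)
have M1ge : 77 / 250 * (N - x - mu - L) <= 2 * M1.
  rewrite -(ler_pM2l (_ : 0 < mr)); last by lra.
  apply: le_trans h1; rewrite mulrA ler_wpM2r //; lra.
have M2ge : 24 / 100 * (M1 + N - 2 * mu - x - L) <= 2 * M2.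
  rewrite -(ler_pM2l (_ : 0 < mr)); last by lra.
  apply: le_trans h2; rewrite mulrA ler_wpM2r //; lra.
(* The extreme case is [y = N / 100], [x = 36 / 25 * y], where the bound is about [0.5054 * N]. *)
lra.
Qed.

Lemma truncn_bounds (R : archiRealFieldType) (x y : R) : x = y -> 0 <= y ->
  y - 1 <= (Num.truncn x)%:R <= y.
Proof.
move=> -> y0; have /andP[-> h] := truncn_itv y0.
by rewrite andbT lerBlDr natr1 ltW.
Qed.

(** Rewrites the numerals of [alpha] and [beta] as products of small ones, the form used in
    [ratio_arithmetic]. *)
Lemma natr_split_div (R : fieldType) a b c d b' c' e : (a = b * c + d)%N -> (e = b' * c')%N ->
  a%:R / e%:R = (b%:R * c%:R + d%:R) / (b'%:R * c'%:R) :> R.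
Proof. by move=> -> ->; rewrite natrD !natrM. Qed.

Lemma natr_split_div_ge0 (R : realFieldType) b c d b' c' m :
  0 <= (b%:R * c%:R + d%:R) / (b'%:R * c'%:R) * m%:R :> R.
Proof. by rewrite -!natrM -natrD ?mulr_ge0 ?invr_ge0 ?ler0n. Qed.

Lemma alphaE : alpha = (43 * 100 + 12) / (100 * 100).
Proof. exact: (@natr_split_div _ _ 43 100 12 100 100). Qed.

Lemma betaE : beta = (75 * 100 + 95) / (100 * 100).
Proof. exact: (@natr_split_div _ _ 75 100 95 100 100). Qed.

Lemma alpha_bounds (m : nat) : let a : rat := (43 * 100 + 12) / (100 * 100) * m%:R in
  a - 1 <= (first_cut m)%:R <= a.
Proof.
rewrite -truncn_alpha; apply: truncn_bounds; first by rewrite alphaE.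
exact: natr_split_div_ge0.
Qed.

Lemma beta_bounds (m : nat) : let b : rat := (75 * 100 + 95) / (100 * 100) * m%:R in
  b - 1 <= (second_cut m)%:R <= b.
Proof.
rewrite -truncn_beta; apply: truncn_bounds; first by rewrite betaE.
exact: natr_split_div_ge0.
Qed.

(** * The expected size of the output *)

Section Ratio.
Variables (A B : finType) (E : {set A * B}).
Local Notation m := #|E|.

Lemma random_order_matching_of pi : ordering_of E pi ->
  matching_of E (random_order_matching m pi).
Proof.
move=> hpi; rewrite (random_order_matchingE (ordering_size hpi)).
have sE e : e \in pi -> e \in E by rewrite (ordering_mem _ hpi).
case: ifP => _; apply/andP; split.
- by apply: subset_trans (augmented_sub _ _ pi) _; apply/subsetP=> e; rewrite inE => /sE.
- exact: augmented_matching.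
- by apply/subsetP=> e /greedy_sub/sE.
- exact: greedy_matching.
Qed.

Lemma random_order_ratio (Ms : {set A * B}) : is_matching Ms -> Ms \subset E ->
  (1 / 2%:R + 5%:R / 1000%:R) * #|Ms|%:R <=
  expectation_over_orderings E (fun pi => #|random_order_matching m pi|%:R : rat).
Proof.
move=> mMs sMs; rewrite (_ : 1 / 2%:R + 5%:R / 1000%:R = 101 / 200 :> rat); last by lra.
have [->|[d dMs]] := set_0Vmem Ms.
  by rewrite cards0 mulr0 -[leLHS](Ex_cst E); apply: Ex_le => pi _; rewrite ler0n.
have N1 : 1 <= #|Ms|%:R :> rat by rewrite ler1n card_gt0; apply/set0Pn; exists d.
have := alpha_bounds m; have := beta_bounds m.
have := fun pi (h : ordering_of E pi) => card_random_order_matching (ordering_size h).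
move: (first_cut m) (second_cut m) => i j ROM hj hi.
have exG : expectation_over_orderings E (fun pi => #|greedy pi|%:R) <=
    expectation_over_orderings E (fun pi => #|random_order_matching m pi|%:R : rat).
  by apply: Ex_le => pi hpi; rewrite (ROM _ hpi) ler_nat leq_maxl.
have exM : expectation_over_orderings E (fun pi => #|augmented i j pi|%:R) <=
    expectation_over_orderings E (fun pi => #|random_order_matching m pi|%:R : rat).
  by apply: Ex_le => pi hpi; rewrite (ROM _ hpi) ler_nat leq_maxr.
have [hG|hG] := lerP (101 / 200 * #|Ms|%:R)
  (expectation_over_orderings E (fun pi => #|greedy pi|%:R)).
  exact: le_trans exG.
apply: le_trans exM; rewrite Ex_augmented.
have [Pm Nm] := matching_density_bound (lt_le_trans ltr01 N1) (card_greedy_ge d mMs sMs)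
  (Ex_greedy_lower mMs sMs) hG (ler0n _ _).
case/andP: (hi) => hi1 hi2; case/andP: (hj) => hj1 hj2.
have i1 : (1 <= i)%N by rewrite -(ler_nat rat); lra.
have ij : (i <= j)%N by rewrite -(ler_nat rat); lra.
have jm : (j <= m)%N by rewrite -(ler_nat rat); lra.
(* The comparison time for [accepts_le]: late enough for greedy to be near [N / 2], early enough to
   leave half of the first phase. *)
pose u := (i %/ 2)%N.
have u1 : u%:R * 2 <= i%:R :> rat by rewrite -natrM ler_nat leq_trunc_div.
have u2 : i%:R <= u%:R * 2 + 1 :> rat.
  have := ltn_ceil i (isT : (0 < 2)%N); rewrite mulSn => h.
  by rewrite -natrM natr1 ler_nat.
move: u u1 u2 => u u1 u2.
have ui : (u <= i)%N by rewrite -(ler_nat rat); lra.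
have im : (i <= m)%N := leq_trans ij jm.
have h2 := Ex_phase2_ge mMs sMs d i1 ij jm.
have h1 := Ex_phase1_ge mMs sMs d i1 ij jm.
have um := leq_trans ui im.
have uim : (u <= i <= m)%N by rewrite ui im.
have hT := accepts_le (E := E) d uim.
have xi := sum_untouched_le sMs d im.
have xu := sum_untouched_le sMs d um.
have y0 t : 0 <= \sum_(e in Ms) Pr E (fun pi => e \in phase0 t pi) <= #|Ms|%:R / 100.
  rewrite sumr_ge0 => [|e _]; last exact: Pr_ge0.
  exact: le_trans (sum_phase0_le E Ms t) Pm.
exact: (ratio_arithmetic (natrB rat im) (natrB rat jm) (natrB rat um) (natrB rat ij)
  (natrB rat ui) (lt_le_trans ltr01 N1) N1 Nm hG hi hj u1 u2 (y0 i) (y0 u)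
  (Ex_phase0_lower E mMs i) (Ex_phase0_lower E mMs u) (Ex_phase0_le E i)
  xi xu (Pr_ge0 E _) hT h1 h2).
Qed.

End Ratio.
End Arithmetic.

(** * The streaming program *)

Section GreedyStep.
Variables A B : finType.
Implicit Types (M F : {set A * B}) (e : A * B) (s : seq (A * B)).

Lemma greedy_restrict_rcons F s e :
  greedy (restrict F (rcons s e)) =
  if (e \in F) && untouched (greedy (restrict F s)) e
  then e |: greedy (restrict F s) else greedy (restrict F s).
Proof. by rewrite /restrict filter_rcons; case: ifP => // _; rewrite greedy_rcons. Qed.

Lemma card_greedy_step M e (b : bool) :
  #|if b && untouched M e then e |: M else M| = #|M| + (b && untouched M e).
Proof.
case: ifP => [/andP[_ /untouchedNin h]|_]; last by rewrite addn0.
by rewrite cardsU1 h addnC.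
Qed.

End GreedyStep.

(** * Matchings as arrays of mates *)

Section Mates.
Variables p q : nat.
Implicit Types (M : {set 'I_p * 'I_q}) (e : 'I_p * 'I_q).

(* The mate of a vertex plus one, and 0 for an unmatched vertex. *)
Definition mateA M (x : nat) : nat :=
  if [pick e in M | val e.1 == x] is Some e then (val e.2).+1 else 0.
Definition mateB M (y : nat) : nat :=
  if [pick e in M | val e.2 == y] is Some e then (val e.1).+1 else 0.

Lemma mateA_in M e : is_matching M -> e \in M -> mateA M e.1 = e.2.+1.
Proof.
move=> mM eM; rewrite /mateA; case: pickP => [f /andP[fM /eqP/val_inj h]|/(_ e)].
  by move/is_matchingP: mM => /(_ f e fM eM (or_introl h)) ->.
by rewrite eM eqxx.
Qed.

Lemma mateB_in M e : is_matching M -> e \in M -> mateB M e.2 = e.1.+1.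
Proof.
move=> mM eM; rewrite /mateB; case: pickP => [f /andP[fM /eqP/val_inj h]|/(_ e)].
  by move/is_matchingP: mM => /(_ f e fM eM (or_intror h)) ->.
by rewrite eM eqxx.
Qed.

Lemma mateA_gt0 M (a : 'I_p) : (0 < mateA M a) = (a \in coverA M).
Proof.
rewrite /mateA; case: pickP => [e /andP[eM /eqP/val_inj <-]|H]; first by rewrite mem_coverA.
by apply/esym/negbTE/imsetP => -[e eM h]; have := H e; rewrite eM h eqxx.
Qed.

Lemma mateB_gt0 M (b : 'I_q) : (0 < mateB M b) = (b \in coverB M).
Proof.
rewrite /mateB; case: pickP => [e /andP[eM /eqP/val_inj <-]|H]; first by rewrite mem_coverB.
by apply/esym/negbTE/imsetP => -[e eM h]; have := H e; rewrite eM h eqxx.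
Qed.

Lemma mateA_le M x : mateA M x <= q.
Proof. by rewrite /mateA; case: pickP => // e _; exact: ltn_ord. Qed.

Lemma mateB_le M x : mateB M x <= p.
Proof. by rewrite /mateB; case: pickP => // e _; exact: ltn_ord. Qed.

Lemma mateA_some M x y : mateA M x = y.+1 -> exists2 e, e \in M & nat_edge e = (x, y).
Proof.
rewrite /mateA; case: pickP => // e /andP[eM /eqP h] [h']; exists e => //.
by rewrite /nat_edge -h -h'.
Qed.

Lemma mateA_set0 x : mateA set0 x = 0.
Proof. by rewrite /mateA; case: pickP => // e; rewrite inE. Qed.

Lemma mateB_set0 x : mateB set0 x = 0.
Proof. by rewrite /mateB; case: pickP => // e; rewrite inE. Qed.

Lemma mateA_setU1 M e x : is_matching M -> untouched M e ->
  mateA (e |: M) x = if x == e.1 then e.2.+1 else mateA M x.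
Proof.
move=> mM ue; have mM' : is_matching (e |: M) by rewrite is_matching_setU1 // ue orbT.
case: eqP => [->|ne]; first by rewrite mateA_in // setU11.
rewrite {1}/mateA; case: pickP => [f /andP[fM /eqP fx]|H].
  by case/setU1P: fM => [fe|fM]; [case: ne; rewrite -fx fe | rewrite -fx mateA_in].
rewrite /mateA; case: pickP => // f /andP[fM fx].
by have := H f; rewrite setU1r // fx.
Qed.

Lemma mateB_setU1 M e x : is_matching M -> untouched M e ->
  mateB (e |: M) x = if x == e.2 then e.1.+1 else mateB M x.
Proof.
move=> mM ue; have mM' : is_matching (e |: M) by rewrite is_matching_setU1 // ue orbT.
case: eqP => [->|ne]; first by rewrite mateB_in // setU11.
rewrite {1}/mateB; case: pickP => [f /andP[fM /eqP fx]|H].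
  by case/setU1P: fM => [fe|fM]; [case: ne; rewrite -fx fe | rewrite -fx mateB_in].
rewrite /mateB; case: pickP => // f /andP[fM fx].
by have := H f; rewrite setU1r // fx.
Qed.

Lemma card_matching_leA M : is_matching M -> #|M| <= p.
Proof. by move=> mM; rewrite -(card_coverA mM) -[leqRHS]card_ord max_card. Qed.

Definition emitted M x : seq (nat * nat) := if mateA M x is y.+1 then [:: (x, y)] else [::].

Lemma emitted_enum M : is_matching M ->
  perm_eq (flatten [seq emitted M x | x <- iota 0 p]) (map (@nat_edge p q) (enum M)).
Proof.
move=> mM; have inj : injective (@nat_edge p q).
  by move=> [a b] [a' b'] [] /val_inj-> /val_inj->.
apply: uniq_perm.
- have em x (e : nat * nat) : e \in emitted M x -> e.1 = x.
    by rewrite /emitted; case: (mateA M x) => // y; rewrite inE => /eqP->.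
  elim: (p) 0 => //= k IH x; rewrite cat_uniq IH andbT; apply/andP; split.
    by rewrite /emitted; case: (mateA M x).
  apply/hasPn => e /flatten_mapP[z]; rewrite mem_iota => hz /em ez.
  by apply/negP => /em; move: hz; lia.
- by rewrite map_inj_uniq ?enum_uniq.
move=> [x y]; apply/flatten_mapP/mapP => [[z _]|[e]].
  rewrite /emitted; case E: (mateA M z) => [|y'] //; rewrite inE => /eqP[-> ->].
  by have [e eM h] := mateA_some E; exists e; rewrite ?mem_enum.
rewrite mem_enum => eM [-> ->]; exists (val e.1); first by rewrite mem_iota /=.
by rewrite /emitted mateA_in // inE.
Qed.

Section AugmentMates.
Variables (i j : nat) (pi : seq ('I_p * 'I_q)).
Local Notation M0 := (phase0 i pi).
Local Notation M1 := (phase1 i j pi).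
Local Notation M2 := (phase2 i j pi).

Lemma mem_rematchable (a : 'I_p) :
  (a \in rematchable i j pi) = (0 < mateA M0 a) && (0 < mateB M1 (mateA M0 a).-1).
Proof.
have m0 : is_matching M0 := greedy_matching _.
rewrite inE; apply/exists_inP/andP => [[b b1 ab]|[]].
  by rewrite (mateA_in m0 ab) /= mateB_gt0.
rewrite mateA_gt0 => /coverAP[b ab]; rewrite (mateA_in m0 ab) /= mateB_gt0 => b1.
by exists b.
Qed.

(** Lets the machine emit the output from the arrays without building it: a vertex of [M0] prefers
    its [M2]-mate, and a vertex outside [M0] uses its [M1] edge only if the [M0]-partner of the far
    end was rematched by [M2]. *)
Lemma mateA_augmented (x : nat) : x < p ->
  mateA (augmented i j pi) x =
  if mateA M0 x is y.+1 then (if mateA M2 x is z.+1 then z.+1 else y.+1)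
  else if (0 < mateA M1 x) && (0 < mateA M2 (mateB M0 (mateA M1 x).-1).-1)
       then mateA M1 x else 0.
Proof.
move=> xp; pose a := Ordinal xp; rewrite -[x]/(val a).
have [m0 m1 m2] : [/\ is_matching M0, is_matching M1 & is_matching M2].
  by split; exact: greedy_matching.
have mM := augmented_matching i j pi.
have s1 : M1 \subset _ := greedy_restrict_sub _ _.
have s2 : M2 \subset _ := greedy_restrict_sub _ _.
have EM : augmented i j pi = _ := augmentE m0 s2.
have inM e : e \in augmented i j pi -> mateA (augmented i j pi) e.1 = e.2.+1.
  exact: mateA_in.
case E0: (mateA M0 a) => [|y].
  have a0 : a \notin coverA M0 by rewrite -mateA_gt0 E0.
  case: ifP => [/andP[]|h].
    rewrite {1}mateA_gt0 => /coverAP[b ab]; rewrite (mateA_in m1 ab) /=.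
    have /coverBP[a' ab'] := (M1_ends s1 ab).2; rewrite (mateB_in m0 ab') /= mateA_gt0 => a2.
    apply: (inM (a, b)); rewrite EM !inE ab /=; apply/orP; right; apply/orP; right.
    by apply/coverBP; exists a'; rewrite inE ab'.
  apply/eqP; rewrite -leqn0 leqNgt mateA_gt0; apply/negP => /coverAP[b].
  rewrite EM !inE /= => /or3P[/andP[_ /mem_coverA]|/(M2_ends s2)[]|/andP[ab /coverBP[a']]].
  - by rewrite (negbTE a0).
  - by rewrite (negbTE a0).
  rewrite inE /= => /andP[ab' a2]; move: h.
  by rewrite (mateA_in m1 ab) /= (mateB_in m0 ab') /= mateA_gt0 a2.
have [b ab yb] : exists2 b, (a, b) \in M0 & y = b.
  have [[a' b] h [ha hb]] := mateA_some E0; exists b => //.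
  by move: h; rewrite (_ : a' = a) //; apply: val_inj.
case E2: (mateA M2 a) => [|z].
  rewrite yb; apply: (inM (a, b)); rewrite EM !inE ab /=.
  by rewrite -mateA_gt0 E2.
have [[a' d] h [ha hb]] := mateA_some E2.
have aa : a' = a by apply: val_inj.
move: h; rewrite aa => ad; rewrite -hb.
by apply: (inM (a, d)); rewrite EM !inE ad orbT.
Qed.

End AugmentMates.
End Mates.

(* Memory layout: cells 0 and 1 hold the current edge and 2 to 4 the parameters;
   5 the number of edges read, 6, 7 and 11 the sizes of M_G, of M_0 plus M_2 and
   of M_1, 8 a loop index, 9 and 10 the ends of the first two phases.  The mates
   of vertex x in the eight interleaved arrays k = 0, ..., 7 (M_G, M_0, M_1, M_2,
   each for the A side, then for the B side) are in the cells 16 + 8 x + k. *)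
Definition slot (k x : nat) := 8 * x + (16 + k).
Definition cell k := Defs.Mem (Cst k).
Definition slotE k e := Bin Add (Bin Mul (Cst 8) e) (Cst (16 + k)).
Definition arr k e := Defs.Mem (slotE k e).
Definition predE e := Bin Defs.Sub e (Cst 1).
Definition succE e := Bin Add e (Cst 1).
Definition posE e := Bin Ltb (Cst 0) e.
Definition nullE e := Bin Eqb e (Cst 0).
(** Conjunction of values 0 and 1, without short circuit: the second factor is evaluated even when
    the first is 0. A lookup through a missing mate then reads the slot of vertex 0, since [predE]
    truncates at 0, and the product masks the result. *)
Definition andE e f := Bin Mul e f.
Definition incr k := Store (Cst k) (succE (cell k)).

Definition try_edge cond kA kB cnt :=
  If (andE cond (andE (nullE (arr kA (cell 0))) (nullE (arr kB (cell 1)))))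
     (Seq (Store (slotE kA (cell 0)) (succE (cell 1)))
          (Seq (Store (slotE kB (cell 1)) (succE (cell 0))) (incr cnt)))
     Skip.

Definition in_F1 := andE (nullE (arr 2 (cell 0))) (posE (arr 3 (cell 1))).
Definition in_F2 :=
  andE (andE (posE (arr 2 (cell 0))) (posE (arr 5 (predE (arr 2 (cell 0))))))
       (nullE (arr 3 (cell 1))).

Definition stream_init :=
  Seq (Store (Cst 9) (Bin Div (Bin Mul (Cst 4312) (cell 4)) (Cst 10000)))
      (Store (Cst 10) (Bin Div (Bin Mul (Cst 7595) (cell 4)) (Cst 10000))).

Definition stream_body :=
  Seq (try_edge (Cst 1) 0 1 6)
      (Seq (If (Bin Ltb (cell 5) (cell 9)) (try_edge (Cst 1) 2 3 7)
               (If (Bin Ltb (cell 5) (cell 10)) (try_edge in_F1 4 5 11)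
                   (try_edge in_F2 6 7 7)))
           (incr 5)).

Definition emit_mate k := Emit (cell 8) (predE (arr k (cell 8))).
Definition emit_greedy := If (arr 0 (cell 8)) (emit_mate 0) Skip.
Definition emit_augmented :=
  If (arr 2 (cell 8))
     (If (arr 6 (cell 8)) (emit_mate 6) (emit_mate 2))
     (If (andE (posE (arr 4 (cell 8)))
               (posE (arr 6 (predE (arr 3 (predE (arr 4 (cell 8))))))))
         (emit_mate 4) Skip).
Definition emit_all c := While (Bin Ltb (cell 8) (cell 2)) (Seq c (incr 8)).
(** By [card_augmented], cell 7 already holds the size of the augmented matching. *)
Definition stream_finish :=
  If (Bin Ltb (cell 6) (cell 7)) (emit_all emit_augmented) (emit_all emit_greedy).

(** The value 0 for a loop is a dummy: each loop execution takes at least one operation, so [runs]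
    never holds of a [While]. Loops are timed separately in [exec_emit_all]. *)
Fixpoint time_bound (c : cmd) : nat :=
  match c with
  | Skip => 1
  | Store e1 e2 | Emit e1 e2 => (cost e1 + cost e2).+1
  | Seq c1 c2 => time_bound c1 + time_bound c2
  | If e c1 c2 => (cost e + maxn (time_bound c1) (time_bound c2)).+1
  | While _ _ => 0
  end.

Lemma slot_eq k x k' x' : k < 8 -> k' < 8 -> (slot k x == slot k' x') = (k == k') && (x == x').
Proof. by rewrite /slot => *; apply/eqP/andP => [h|[/eqP-> /eqP->] //]; split; apply/eqP; lia. Qed.

Lemma slot_cell k x z : z < 16 -> (slot k x == z) = false.
Proof. by rewrite /slot; lia. Qed.

Lemma cell_slot k x z : z < 16 -> (z == slot k x) = false.
Proof. by rewrite /slot; lia. Qed.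

(** * Execution without overflow: results bounded by [bd] never wrap around *)

Section Machine.
Variables w S bd n : nat.
Hypotheses (bdw : bd < 2 ^ w) (nS : 24 + 8 * n <= S) (nbd : 24 + 8 * n <= bd).
Implicit Types (mu : memory) (out : seq (nat * nat)).
Local Notation ev mu e v := (eval w S mu e = Some (v : nat)).

Definition runs c st st' := exists2 k, exec w S c st k st' & k <= time_bound c.

Lemma runs_skip st : runs Skip st st.
Proof. by exists 1 => //; constructor. Qed.

Lemma runs_seq c1 c2 st st1 st2 : runs c1 st st1 -> runs c2 st1 st2 -> runs (Seq c1 c2) st st2.
Proof.
move=> [k1 h1 l1] [k2 h2 l2]; exists (k1 + k2); first exact: exec_seq h1 h2.
exact: leq_add.
Qed.

Lemma runs_if e v c1 c2 mu out st : ev mu e v ->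
  runs (if v != 0 then c1 else c2) (State mu out) st -> runs (If e c1 c2) (State mu out) st.
Proof.
move=> he [k h l]; exists (cost e + k).+1; first exact: (exec_if (st := State mu out) he h).
by rewrite ltnS leq_add2l (leq_trans l) //; case: ifP => _; rewrite ?leq_maxl ?leq_maxr.
Qed.

Lemma runs_store e1 e2 mu out x v : ev mu e1 x -> x < S -> ev mu e2 v ->
  runs (Store e1 e2) (State mu out) (State (upd w mu x v) out).
Proof. by move=> h1 h2 h3; exists (cost e1 + cost e2).+1 => //; apply: exec_store. Qed.

Lemma runs_emit e1 e2 mu out x y : ev mu e1 x -> ev mu e2 y ->
  runs (Emit e1 e2) (State mu out) (State mu (rcons out (x, y))).
Proof. by move=> h1 h2; exists (cost e1 + cost e2).+1 => //; apply: exec_emit. Qed.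

Lemma ev_cst mu k : k <= bd -> ev mu (Cst k) k.
Proof. by move=> h /=; rewrite modn_small // (leq_ltn_trans h). Qed.

Lemma ev_mem mu e x : ev mu e x -> x < S -> ev mu (Defs.Mem e) (mu x).
Proof. by move=> /= -> ->. Qed.

Lemma ev_bin mu o e1 e2 x y z : ev mu e1 x -> ev mu e2 y -> binop_fun o x y = z -> z <= bd ->
  ev mu (Bin o e1 e2) z.
Proof. by move=> /= -> -> -> h; rewrite modn_small // (leq_ltn_trans h). Qed.

Lemma ev_cell mu k : k < 16 -> ev mu (cell k) (mu k).
Proof. by move=> h; apply: ev_mem; [apply: ev_cst; lia | lia]. Qed.

Lemma ev_slot mu k e x : k < 8 -> x <= n -> ev mu e x -> ev mu (slotE k e) (slot k x).
Proof.
move=> hk hx he; apply: (@ev_bin _ _ _ _ (8 * x) (16 + k)) => //; last by rewrite /slot; lia.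
  by apply: (@ev_bin _ _ _ _ 8 x) => //; [apply: ev_cst; lia | lia].
by apply: ev_cst; lia.
Qed.

Lemma slot_lt k x : k < 8 -> x <= n -> slot k x < S.
Proof. by rewrite /slot; lia. Qed.

Lemma ev_arr mu k e x : k < 8 -> x <= n -> ev mu e x -> ev mu (arr k e) (mu (slot k x)).
Proof. by move=> hk hx he; apply: ev_mem (slot_lt hk hx); apply: ev_slot. Qed.

Lemma ev_pred mu e x : ev mu e x -> x <= bd -> ev mu (predE e) x.-1.
Proof.
move=> h l; apply: ev_bin h (ev_cst _ _) _ _; first by lia.
  by rewrite /= subn1.
by lia.
Qed.

Lemma ev_succ mu e x : ev mu e x -> x < bd -> ev mu (succE e) x.+1.
Proof. by move=> h l; apply: ev_bin h (ev_cst _ _) _ _; rewrite //= ?addn1; lia. Qed.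

Lemma ev_pos mu e x : ev mu e x -> ev mu (posE e) (0 < x : bool).
Proof.
by move=> h; apply: ev_bin (ev_cst _ _) h _ _; rewrite //; case: (0 < x) => //=; lia.
Qed.

Lemma ev_null mu e x : ev mu e x -> ev mu (nullE e) (x == 0).
Proof.
by move=> h; apply: ev_bin h (ev_cst _ _) _ _; rewrite //; case: (x == 0) => //=; lia.
Qed.

Lemma ev_and mu e f (x y : bool) : ev mu e x -> ev mu f y -> ev mu (andE e f) (x && y).
Proof. by move=> h h'; apply: ev_bin h h' _ _; rewrite /= ?mulnb //; case: (x && y); lia. Qed.

Lemma ev_ltb mu e f x y : ev mu e x -> ev mu f y -> ev mu (Bin Ltb e f) (x < y).
Proof. by move=> h h'; apply: ev_bin h h' _ _; rewrite //; case: (x < y) => //=; lia. Qed.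

Lemma updE mu x v z : v <= bd -> upd w mu x v z = if z == x then v else mu z.
Proof. by move=> h; rewrite /upd modn_small // (leq_ltn_trans h). Qed.

Lemma runs_incr k mu out : k < 16 -> mu k < bd ->
  runs (incr k) (State mu out) (State (upd w mu k (mu k).+1) out).
Proof.
move=> hk hb; apply: runs_store; [apply: ev_cst; lia | lia |].
by apply: ev_succ => //; apply: ev_cell.
Qed.

Section Side.
Variables p q : nat.
Hypothesis pq : p + q = n.
Implicit Types (M : {set 'I_p * 'I_q}) (e : 'I_p * 'I_q).

Definition stores mu kA kB M :=
  (forall x, mu (slot kA x) = mateA M x) /\ (forall x, mu (slot kB x) = mateB M x).

Lemma stores_eq mu mu' kA kB M : (forall x, mu' (slot kA x) = mu (slot kA x)) ->
  (forall x, mu' (slot kB x) = mu (slot kB x)) -> stores mu kA kB M -> stores mu' kA kB M.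
Proof. by move=> hA hB [sA sB]; split=> x; rewrite ?hA ?hB. Qed.

(** The last two clauses are frame conditions, which carry the other three matchings and the other
    counters through the step. *)
Lemma runs_try_edge mu out cond (c : bool) kA kB cnt M e :
  kA < 8 -> kB < 8 -> kA != kB -> 2 <= cnt < 16 -> is_matching M -> stores mu kA kB M ->
  mu 0 = nat_of_ord e.1 -> mu 1 = nat_of_ord e.2 -> ev mu cond c -> mu cnt < bd ->
  let take_it := c && untouched M e in
  exists mu', [/\ runs (try_edge cond kA kB cnt) (State mu out) (State mu' out),
    stores mu' kA kB (if take_it then e |: M else M),
    mu' cnt = mu cnt + take_it,
    (forall z, z < 16 -> z != cnt -> mu' z = mu z) &
    (forall k x, k < 8 -> k != kA -> k != kB -> mu' (slot k x) = mu (slot k x))].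
Proof.
move=> hkA hkB kAB /andP[c2 c16] mM [sA sB] m0 m1 hc hcnt take_it.
have a_p : nat_of_ord e.1 <= n by rewrite -pq (leq_trans (ltnW (ltn_ord e.1))) ?leq_addr.
have b_q : nat_of_ord e.2 <= n by rewrite -pq (leq_trans (ltnW (ltn_ord e.2))) ?leq_addl.
have a_bd : nat_of_ord e.1 < bd by apply: (leq_ltn_trans a_p); lia.
have b_bd : nat_of_ord e.2 < bd by apply: (leq_ltn_trans b_q); lia.
have evtest : ev mu (andE cond (andE (nullE (arr kA (cell 0))) (nullE (arr kB (cell 1))))) take_it.
  apply: ev_and => //; rewrite /untouched -mateA_gt0 -mateB_gt0 -!eqn0Ngt -sA -sB.
  have c0 : ev mu (cell 0) (nat_of_ord e.1) by rewrite -m0; apply: ev_cell.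
  have c1 : ev mu (cell 1) (nat_of_ord e.2) by rewrite -m1; apply: ev_cell.
  by apply: ev_and; apply: ev_null; apply: ev_arr.
have [tk|tk] := boolP take_it; last first.
  exists mu; split=> //; last by rewrite addn0.
  by apply: runs_if evtest _; rewrite (negbTE tk); exact: runs_skip.
pose mu1 := upd w mu (slot kA e.1) (nat_of_ord e.2).+1.
pose mu2 := upd w mu1 (slot kB e.2) (nat_of_ord e.1).+1.
have e1 z : mu1 z = if z == slot kA e.1 then (nat_of_ord e.2).+1 else mu z by rewrite /mu1 updE.
have e2 z : mu2 z = if z == slot kB e.2 then (nat_of_ord e.1).+1 else mu1 z by rewrite /mu2 updE.
have mu2c z : z < 16 -> mu2 z = mu z by move=> hz; rewrite e2 e1 !cell_slot.
pose mu3 := upd w mu2 cnt (mu2 cnt).+1.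
have e3 z : mu3 z = if z == cnt then (mu cnt).+1 else mu2 z.
  by rewrite /mu3 updE mu2c //; lia.
exists mu3; split.
- apply: runs_if evtest _; rewrite tk /=.
  apply: (@runs_seq _ _ _ (State mu1 out)).
    apply: runs_store; last 1 first.
    + by apply: ev_succ; [rewrite -m1; exact: ev_cell | ].
    + by apply: ev_slot => //; rewrite -m0; exact: ev_cell.
    + exact: slot_lt.
  apply: (@runs_seq _ _ _ (State mu2 out)).
    apply: runs_store; last 1 first.
    + have -> : nat_of_ord e.1 = mu1 0 by rewrite e1 cell_slot.
      by apply: ev_succ; [exact: ev_cell | rewrite e1 cell_slot // m0].
    + apply: ev_slot => //.
      have -> : nat_of_ord e.2 = mu1 1 by rewrite e1 cell_slot.
      exact: ev_cell.
    + exact: slot_lt.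
  by apply: runs_incr; rewrite ?mu2c.
- move: tk => /andP[_ ue]; split=> x.
    rewrite mateA_setU1 // e3 slot_cell // e2 slot_eq // (negbTE kAB) /= e1 slot_eq // eqxx /=.
    by rewrite sA.
  rewrite mateB_setU1 // e3 slot_cell // e2 slot_eq // eqxx /=.
  case: ifP => // _; rewrite e1 slot_eq // eq_sym (negbTE kAB) /=.
  by rewrite sB.
- by rewrite e3 eqxx addn1.
- by move=> z hz nz; rewrite e3 (negbTE nz) mu2c.
- move=> k x hk nA nB; rewrite e3 slot_cell // e2 slot_eq // (negbTE nB) /=.
  by rewrite e1 slot_eq // (negbTE nA).
Qed.

(** * The invariant of the pass *)

Section Stream.
Variables i j : nat.
Variable pi : seq ('I_p * 'I_q).
Hypotheses (szbd : size pi < bd) (ij : i <= j) (jm : j <= size pi).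
Local Notation F1 := (setX (~: coverA (phase0 i pi)) (coverB (phase0 i pi))).
Local Notation F2 := (setX (rematchable i j pi) (~: coverB (phase0 i pi))).

Definition MG t := greedy (take t pi).
Definition M0 t := phase0 (minn t i) pi.
(** The filters refer to completed phases at every time [t]. This agrees with the machine, because
    [M1] stays empty until [M0] is final, and [M2] until [M1] is. *)
Definition M1 t := greedy (restrict F1 (drop i (take (minn t j) pi))).
Definition M2 t := greedy (restrict F2 (drop j (take t pi))).

Definition stream_invariant mu t :=
  [/\ mu 2 = p, mu 5 = t, mu 8 = 0, mu 9 = i & mu 10 = j] /\
  [/\ mu 6 = #|MG t|, mu 7 = #|M0 t| + #|M2 t| & mu 11 = #|M1 t|] /\
  [/\ stores mu 0 1 (MG t), stores mu 2 3 (M0 t), stores mu 4 5 (M1 t) & stores mu 6 7 (M2 t)].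

Lemma MG_step d t : t < size pi ->
  MG t.+1 = if true && untouched (MG t) (nth d pi t) then nth d pi t |: MG t else MG t.
Proof. by move=> h; rewrite /MG (take_nth d h) greedy_rcons. Qed.

Lemma M0_step d t : t < i -> t < size pi ->
  M0 t.+1 = if true && untouched (M0 t) (nth d pi t) then nth d pi t |: M0 t else M0 t.
Proof.
move=> ti h; rewrite /M0 (minn_idPl ti) (minn_idPl (ltnW ti)).
by rewrite /phase0 (take_nth d h) greedy_rcons.
Qed.

Lemma M0_stable t : i <= t -> M0 t = phase0 i pi.
Proof. by move=> h; rewrite /M0 (minn_idPr h). Qed.

Lemma M1_early t : t <= i -> M1 t = greedy [::].
Proof.
move=> h; rewrite /M1 drop_oversize // size_take; case: ltnP => h'; last by apply: leq_trans h' _; lia.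
by apply: leq_trans (geq_minl _ _) h.
Qed.

Lemma M1_step d t : i <= t < j -> t < size pi ->
  M1 t.+1 = if (nth d pi t \in F1) && untouched (M1 t) (nth d pi t)
            then nth d pi t |: M1 t else M1 t.
Proof.
case/andP=> it tj h; rewrite /M1 (minn_idPl tj) (minn_idPl (ltnW tj)).
rewrite (take_nth d h) drop_rcons ?greedy_restrict_rcons //.
by rewrite size_takel // ltnW.
Qed.

Lemma M1_stable t : j <= t -> M1 t = phase1 i j pi.
Proof. by move=> h; rewrite /M1 (minn_idPr h). Qed.

Lemma M2_early t : t <= j -> M2 t = greedy [::].
Proof. by move=> h; rewrite /M2 drop_oversize // size_take; case: ltnP => //; lia. Qed.

Lemma M2_step d t : j <= t -> t < size pi ->
  M2 t.+1 = if (nth d pi t \in F2) && untouched (M2 t) (nth d pi t)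
            then nth d pi t |: M2 t else M2 t.
Proof.
move=> jt h; rewrite /M2 (take_nth d h) drop_rcons ?greedy_restrict_rcons //.
by rewrite size_takel // ltnW.
Qed.

Lemma M2_final : M2 (size pi) = phase2 i j pi.
Proof. by rewrite /M2 take_size. Qed.

Lemma card_matching_le M : is_matching M -> #|(M : {set 'I_p * 'I_q})| <= n.
Proof. by move=> /card_matching_leA h; rewrite -pq (leq_trans h) ?leq_addr. Qed.

Lemma ev_in_F1 mu e : stores mu 2 3 (phase0 i pi) -> mu 0 = e.1 -> mu 1 = e.2 ->
  ev mu in_F1 (e \in F1).
Proof.
case: e => a b [sA sB] m0 m1.
have {}m0 : mu 0 = a := m0; have {}m1 : mu 1 = b := m1.
rewrite in_setX in_setC -mateA_gt0 -mateB_gt0 -eqn0Ngt -sA -sB.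
have a_n : a <= n by rewrite -pq (leq_trans (ltnW (ltn_ord a))) ?leq_addr.
have b_n : b <= n by rewrite -pq (leq_trans (ltnW (ltn_ord b))) ?leq_addl.
apply: ev_and.
  by apply: ev_null; apply: ev_arr => //; rewrite -m0; apply: ev_cell.
by apply: ev_pos; apply: ev_arr => //; rewrite -m1; apply: ev_cell.
Qed.

Lemma ev_in_F2 mu e : stores mu 2 3 (phase0 i pi) -> stores mu 4 5 (phase1 i j pi) ->
  mu 0 = e.1 -> mu 1 = e.2 -> ev mu in_F2 (e \in F2).
Proof.
case: e => a b [sA sB] [sA1 sB1] m0 m1.
have {}m0 : mu 0 = a := m0; have {}m1 : mu 1 = b := m1.
rewrite in_setX in_setC mem_rematchable.
rewrite -mateB_gt0 -eqn0Ngt.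
have a_n : a <= n by rewrite -pq (leq_trans (ltnW (ltn_ord a))) ?leq_addr.
have b_n : b <= n by rewrite -pq (leq_trans (ltnW (ltn_ord b))) ?leq_addl.
have ma_n : mateA (phase0 i pi) a <= n by rewrite -pq (leq_trans (mateA_le _ _)) ?leq_addl.
have evA : ev mu (arr 2 (cell 0)) (mateA (phase0 i pi) a).
  by rewrite -sA; apply: ev_arr => //; rewrite -m0; apply: ev_cell.
apply: ev_and; last first.
  rewrite -sB; apply: ev_null; apply: ev_arr => //.
  by rewrite -m1; apply: ev_cell.
apply: ev_and; first by apply: ev_pos.
rewrite -sB1; apply: ev_pos; apply: ev_arr => //.
  by apply: leq_trans (leq_pred _) ma_n.
by apply: ev_pred => //; apply: leq_trans ma_n _; lia.
Qed.

(** Besides [MG], only one of [M0], [M1], [M2] is active at a given time; the others are still empty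
    or already final. *)
Lemma runs_stream_body mu out t d : t < size pi -> stream_invariant mu t ->
  exists2 mu', runs stream_body (read_edge w (State mu out) (nat_edge (nth d pi t))) (State mu' out)
    & stream_invariant mu' t.+1.
Proof.
move=> tm [[i2 i5 i8 i9 i10] [[i6 i7 i11] [sG s0 s1 s2]]].
set e := nth d pi t.
have a_n : e.1 <= n by rewrite -pq (leq_trans (ltnW (ltn_ord e.1))) ?leq_addr.
have b_n : e.2 <= n by rewrite -pq (leq_trans (ltnW (ltn_ord e.2))) ?leq_addl.
rewrite /read_edge /=; set mu0 := upd w _ 1 _.
have e0 z : mu0 z = if z == 1 then nat_of_ord e.2 else if z == 0 then nat_of_ord e.1 else mu z.
  rewrite /mu0 updE; last by apply: leq_trans b_n _; lia.
  by rewrite updE //; apply: leq_trans a_n _; lia.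
have s0eq k x : mu0 (slot k x) = mu (slot k x) by rewrite e0 !slot_cell.
have e0c z : 1 < z -> mu0 z = mu z by move=> hz; rewrite e0; do !case: eqP => //; lia.
have matG t' : is_matching (MG t') := greedy_matching _.
have mat0 t' : is_matching (M0 t') := greedy_matching _.
have mat1 t' : is_matching (M1 t') := greedy_matching _.
have mat2 t' : is_matching (M2 t') := greedy_matching _.
have bnd c : c <= n + n -> c < bd by lia.
have bd1 : 1 <= bd by lia.
have cle M : is_matching M -> #|(M : {set 'I_p * 'I_q})| <= n by exact: card_matching_le.
have c6 : mu0 6 < bd by rewrite e0c // i6; apply: bnd; rewrite (leq_trans (cle _ (matG t))) ?leq_addr.
have [mu1 [r1 sG1 c1 f1 g1]] := @runs_try_edge mu0 out (Cst 1) true 0 1 6 (MG t) e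
  isT isT isT isT (matG t) (stores_eq (s0eq 0) (s0eq 1) sG) (e0 0) (e0 1) (ev_cst _ bd1) c6.
rewrite -MG_step // in sG1.
have f10 z : 1 < z < 16 -> z != 6 -> mu1 z = mu z by move=> /andP[? ?] ?; rewrite f1 ?e0c.
have st k x : 1 < k < 8 -> mu1 (slot k x) = mu (slot k x).
  by move=> /andP[h1 h8]; rewrite g1 ?s0eq //; lia.
have s01 : stores mu1 2 3 (M0 t) by apply: stores_eq s0 => x; exact: st.
have s11 : stores mu1 4 5 (M1 t) by apply: stores_eq s1 => x; exact: st.
have s21 : stores mu1 6 7 (M2 t) by apply: stores_eq s2 => x; exact: st.
have m10 : mu1 0 = e.1 by rewrite f1 // e0.
have m11 : mu1 1 = e.2 by rewrite f1 // e0.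
have c7 : mu1 7 < bd by rewrite f10 // i7; apply: bnd; apply: leq_add; exact: cle.
have c11 : mu1 11 < bd.
  by rewrite f10 // i11; apply: bnd; rewrite (leq_trans (cle _ (mat1 t))) ?leq_addr.
have [mu2 [r2 [sG2 s02 s12 s22] c27 c211 f2]] : exists mu2,
  [/\ runs (If (Bin Ltb (cell 5) (cell 9)) (try_edge (Cst 1) 2 3 7)
               (If (Bin Ltb (cell 5) (cell 10)) (try_edge in_F1 4 5 11) (try_edge in_F2 6 7 7)))
        (State mu1 out) (State mu2 out),
      [/\ stores mu2 0 1 (MG t.+1), stores mu2 2 3 (M0 t.+1), stores mu2 4 5 (M1 t.+1)
        & stores mu2 6 7 (M2 t.+1)],
      mu2 7 = #|M0 t.+1| + #|M2 t.+1|, mu2 11 = #|M1 t.+1|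
    & forall z, z < 16 -> z != 7 -> z != 11 -> mu2 z = mu1 z].
  have ev1 : ev mu1 (Bin Ltb (cell 5) (cell 9)) (t < i).
    by rewrite -{1}i5 -{1}i9 -(f10 5) // -(f10 9) //; apply: ev_ltb; exact: ev_cell.
  have ev2 : ev mu1 (Bin Ltb (cell 5) (cell 10)) (t < j).
    by rewrite -{1}i5 -{1}i10 -(f10 5) // -(f10 10) //; apply: ev_ltb; exact: ev_cell.
  have [ti|it] := ltnP t i.
    have [mu2 [r2 s02 c2 f2 g2]] := @runs_try_edge mu1 out (Cst 1) true 2 3 7 (M0 t) e
      isT isT isT isT (mat0 t) s01 m10 m11 (ev_cst _ bd1) c7.
    have ti' := leq_trans ti ij.
    have EM1 : M1 t.+1 = M1 t by rewrite !M1_early // ltnW.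
    have EM2 : M2 t.+1 = M2 t by rewrite !M2_early // ltnW.
    have cM0 := card_greedy_step (M0 t) e true.
    rewrite -M0_step // in s02 cM0.
    exists mu2; split.
    - by apply: runs_if ev1 _; rewrite ti.
    - rewrite EM1 EM2; split=> //.
      + by apply: stores_eq sG1 => x; rewrite g2.
      + by apply: stores_eq s11 => x; rewrite g2.
      + by apply: stores_eq s21 => x; rewrite g2.
    - by rewrite c2 EM2 cM0 f10 // i7; lia.
    - by rewrite f2 // f10 // EM1.
    - by move=> z hz h7 _; rewrite f2.
  have EM0 : M0 t.+1 = M0 t by rewrite !M0_stable // ltnW.
  have s0f : stores mu1 2 3 (phase0 i pi) by rewrite -(M0_stable it).
  have [tj|jt] := ltnP t j.
    have [mu2 [r2 s12 c2 f2 g2]] := @runs_try_edge mu1 out in_F1 (e \in F1) 4 5 11 (M1 t) e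
      isT isT isT isT (mat1 t) s11 m10 m11 (ev_in_F1 s0f m10 m11) c11.
    have EM2 : M2 t.+1 = M2 t by rewrite !M2_early // ltnW.
    have cM1 := card_greedy_step (M1 t) e (e \in F1).
    rewrite -M1_step ?it // in s12 cM1.
    exists mu2; split.
    - apply: runs_if ev1 _; rewrite ltnNge it /=.
      by apply: runs_if ev2 _; rewrite tj.
    - rewrite EM0 EM2; split=> //.
      + by apply: stores_eq sG1 => x; rewrite g2.
      + by apply: stores_eq s01 => x; rewrite g2.
      + by apply: stores_eq s21 => x; rewrite g2.
    - by rewrite EM0 EM2 f2 // f10 // i7.
    - by rewrite c2 cM1 f10 // i11.
    - by move=> z hz _ h11; rewrite f2.
  have s1f : stores mu1 4 5 (phase1 i j pi) by rewrite -(M1_stable jt).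
  have [mu2 [r2 s22 c2 f2 g2]] := @runs_try_edge mu1 out in_F2 (e \in F2) 6 7 7 (M2 t) e
    isT isT isT isT (mat2 t) s21 m10 m11 (ev_in_F2 s0f s1f m10 m11) c7.
  have EM1 : M1 t.+1 = M1 t by rewrite !M1_stable // ltnW.
  have cM2 := card_greedy_step (M2 t) e (e \in F2).
  rewrite -M2_step // in s22 cM2.
  exists mu2; split.
  - apply: runs_if ev1 _; rewrite ltnNge it /=.
    by apply: runs_if ev2 _; rewrite ltnNge jt.
  - rewrite EM0 EM1; split=> //.
    + by apply: stores_eq sG1 => x; rewrite g2.
    + by apply: stores_eq s01 => x; rewrite g2.
    + by apply: stores_eq s11 => x; rewrite g2.
  - by rewrite c2 EM0 cM2 f10 // i7; lia.
  - by rewrite EM1 f2 // f10.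
  - by move=> z hz h7 _; rewrite f2.
have t5 : mu2 5 = t by rewrite f2 // f10.
pose mu3 := upd w mu2 5 (mu2 5).+1.
have e3 z : mu3 z = if z == 5 then t.+1 else mu2 z.
  by rewrite /mu3 updE t5 //; lia.
have s3 kA kB M : stores mu2 kA kB M -> stores mu3 kA kB M.
  by apply: stores_eq => x; rewrite e3 slot_cell.
exists mu3.
  apply: runs_seq r1 _; apply: runs_seq r2 _; apply: runs_incr => //.
  by rewrite t5; lia.
split; last split.
- by split; rewrite e3 //= f2 // f10.
- split; rewrite e3 //= f2 // c1 e0c // i6.
  by have := card_greedy_step (MG t) e true; rewrite -MG_step // => ->.
- by split; apply: s3.
Qed.

Lemma runs_stream mu out t : t <= size pi -> stream_invariant mu t ->
  exists2 mu', pass w S stream_body (time_bound stream_body) (State mu out)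
      (map (@nat_edge p q) (drop t pi)) (State mu' out)
    & stream_invariant mu' (size pi).
Proof.
move=> tm; have [k] : exists k, k + t = size pi by exists (size pi - t); lia.
elim: k mu t tm => [|k IH] mu t tm kt inv.
  exists mu; first by rewrite drop_oversize; [constructor | lia].
  by rewrite -kt.
have ts : t < size pi by lia.
(* The nonempty stream itself supplies the default edge for [nth]. *)
case E: pi => [|d pi']; first by rewrite E in ts.
rewrite -E (drop_nth d ts) /=.
have [mu1 [k1 r1 l1] inv1] := runs_stream_body out d ts inv.
have [mu2 r2 inv2] := IH mu1 t.+1 ts (ltac:(lia)) inv1.
by exists mu2 => //; apply: pass_cons r1 l1 r2.
Qed.

Definition loop_bound c :=
  cost (Bin Ltb (cell 8) (cell 2)) + time_bound c + time_bound (incr 8) + 1.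

(** The body changes only the output, so cell 8 is the only cell in which the memory departs from
    [mu] during the loop. *)
Lemma exec_emit_all c (f : nat -> seq (nat * nat)) mu out :
  mu 2 = p -> mu 8 = 0 ->
  (forall mu' out' x, x < p -> (forall z, z != 8 -> mu' z = mu z) -> mu' 8 = x ->
     runs c (State mu' out') (State mu' (out' ++ f x))) ->
  exists k st, [/\ exec w S (emit_all c) (State mu out) k st, k <= p.+1 * loop_bound c
    & out_of st = out ++ flatten [seq f x | x <- iota 0 p]].
Proof.
move=> m2 m8 Hc.
suff H r x mu' out' : x + r = p -> (forall z, z != 8 -> mu' z = mu z) -> mu' 8 = x ->
    exists k st, [/\ exec w S (emit_all c) (State mu' out') k st, k <= r.+1 * loop_bound c
      & out_of st = out' ++ flatten [seq f x | x <- iota x r]].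
  exact: H.
have p_n : p <= n by rewrite -pq leq_addr.
elim: r x mu' out' => [|r IH] x mu' out' xr hz hx.
  have evc : ev mu' (Bin Ltb (cell 8) (cell 2)) 0.
    have := ev_ltb (ev_cell mu' (isT : 8 < 16)) (ev_cell mu' (isT : 2 < 16)).
    by rewrite hx hz // m2 -xr addn0 ltnn.
  exists (cost (Bin Ltb (cell 8) (cell 2))).+1, (State mu' out'); split.
  - by apply: exec_while_stop; exact: evc.
  - by rewrite mul1n /loop_bound; lia.
  - by rewrite cats0.
have xp : x < p by lia.
have evc : ev mu' (Bin Ltb (cell 8) (cell 2)) 1.
  have := ev_ltb (ev_cell mu' (isT : 8 < 16)) (ev_cell mu' (isT : 2 < 16)).
  by rewrite hx hz // m2 xp.
have [k1 r1 l1] := Hc mu' out' x xp hz hx.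
have x8 : mu' 8 < bd by rewrite hx; lia.
have [k2 r2 l2] := runs_incr (out' ++ f x) (isT : 8 < 16) x8.
pose mu2 := upd w mu' 8 (mu' 8).+1.
have e2 z : mu2 z = if z == 8 then x.+1 else mu' z by rewrite /mu2 updE hx //; lia.
have hz2 z : z != 8 -> mu2 z = mu z by move=> h; rewrite e2 (negbTE h) hz.
have [k3 [st [r3 l3 o3]]] := IH x.+1 mu2 (out' ++ f x) (ltac:(lia)) hz2 (e2 8).
exists (cost (Bin Ltb (cell 8) (cell 2)) + (k1 + k2) + k3).+1, st; split.
- by apply: exec_while_loop (exec_seq r1 r2) r3; first exact: evc.
- by rewrite mulSn; move: l1 l2 l3; rewrite /loop_bound; lia.
- by rewrite o3 /= catA.
Qed.

Lemma runs_emit_mate mu out k x M : k < 8 -> mu 8 = x -> x <= n ->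
  mu (slot k x) = mateA M x -> 0 < mateA M x ->
  runs (emit_mate k) (State mu out) (State mu (out ++ emitted M x)).
Proof.
move=> hk m8 xn sk; rewrite /emitted; case E: (mateA M x) => [|y] // _.
rewrite cats1; apply: runs_emit; first by rewrite -m8; exact: ev_cell.
rewrite -[y]/(y.+1.-1) -E -sk; apply: ev_pred.
  by apply: ev_arr => //; rewrite -m8; exact: ev_cell.
rewrite sk; apply: leq_trans (mateA_le _ _) _; lia.
Qed.

Lemma runs_emit_greedy mu out x : mu 8 = x -> x < p -> stores mu 0 1 (MG (size pi)) ->
  runs emit_greedy (State mu out) (State mu (out ++ emitted (greedy pi) x)).
Proof.
move=> m8 xp [sA _]; rewrite /MG take_size in sA.
have xn : x <= n by rewrite -pq; lia.
have ev0 : ev mu (arr 0 (cell 8)) (mateA (greedy pi) x).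
  by rewrite -sA; apply: ev_arr => //; rewrite -m8; exact: ev_cell.
apply: runs_if ev0 _; case: eqP => [h|/eqP h] /=.
  by rewrite /emitted h cats0; exact: runs_skip.
by apply: runs_emit_mate => //; rewrite lt0n.
Qed.

Lemma runs_emit_augmented mu out x : mu 8 = x -> x < p ->
  stores mu 2 3 (phase0 i pi) -> stores mu 4 5 (phase1 i j pi) -> stores mu 6 7 (phase2 i j pi) ->
  runs emit_augmented (State mu out) (State mu (out ++ emitted (augmented i j pi) x)).
Proof.
move=> m8 xp [sA0 sB0] [sA1 _] [sA2 _]; have xn : x <= n by rewrite -pq; lia.
have c8 : ev mu (cell 8) x by rewrite -m8; exact: ev_cell.
have eva k : k < 8 -> ev mu (arr k (cell 8)) (mu (slot k x)) by move=> hk; exact: ev_arr.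
have An M y : mateA (M : {set 'I_p * 'I_q}) y <= n.
  by rewrite -pq (leq_trans (mateA_le _ _)) ?leq_addl.
have Bn M y : mateB (M : {set 'I_p * 'I_q}) y <= n.
  by rewrite -pq (leq_trans (mateB_le _ _)) ?leq_addr.
have mA := mateA_augmented i j pi xp.
have emitE M : mateA M x = mateA (augmented i j pi) x -> emitted (augmented i j pi) x = emitted M x.
  by rewrite /emitted => ->.
apply: runs_if (eva 2 isT) _; rewrite sA0; case E0: (mateA (phase0 i pi) x) mA => [|y] mA /=.
  set t1 := mateA (phase1 i j pi) x in mA.
  have evt : ev mu (andE (posE (arr 4 (cell 8)))
      (posE (arr 6 (predE (arr 3 (predE (arr 4 (cell 8))))))))
      ((0 < t1) && (0 < mateA (phase2 i j pi) (mateB (phase0 i pi) t1.-1).-1)).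
    have e4 : ev mu (arr 4 (cell 8)) t1 by rewrite /t1 -sA1; exact: eva.
    have t1n : t1 <= n by exact: An.
    apply: ev_and; apply: ev_pos => //; rewrite -sA2; apply: ev_arr => //.
      by apply: leq_trans (leq_pred _) _; exact: Bn.
    apply: ev_pred; last by apply: leq_trans (Bn _ _) _; lia.
    rewrite -sB0; apply: ev_arr => //; first by lia.
    by apply: ev_pred => //; lia.
  apply: runs_if evt _; case: ifP mA => h mA /=.
    by rewrite (emitE (phase1 i j pi)) //; apply: runs_emit_mate => //; case/andP: h.
  by rewrite /emitted mA cats0; exact: runs_skip.
apply: runs_if (eva 6 isT) _; rewrite sA2; case E2: (mateA (phase2 i j pi) x) mA => [|z] mA /=.
  by rewrite (emitE (phase0 i pi)) ?E0 //; apply: runs_emit_mate => //; rewrite E0.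
by rewrite (emitE (phase2 i j pi)) ?E2 //; apply: runs_emit_mate => //; rewrite E2.
Qed.

Lemma exec_stream_finish mu : stream_invariant mu (size pi) ->
  exists k st, [/\ exec w S stream_finish (State mu [::]) k st,
    k <= n.+1 * (cost (Bin Ltb (cell 6) (cell 7)) + 1 +
                 loop_bound emit_augmented + loop_bound emit_greedy)
    & out_of st = flatten [seq emitted (if #|greedy pi| < #|augmented i j pi|
                                        then augmented i j pi else greedy pi) x | x <- iota 0 p]].
Proof.
move=> [[i2 i5 i8 i9 i10] [[i6 i7 i11] [sG s0 s1 s2]]].
rewrite M0_stable ?(leq_trans ij) // M2_final in i7 s0 s2.
rewrite M1_stable // in s1.
have evc : ev mu (Bin Ltb (cell 6) (cell 7)) (#|greedy pi| < #|augmented i j pi|).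
  have := ev_ltb (ev_cell mu (isT : 6 < 16)) (ev_cell mu (isT : 7 < 16)).
  by rewrite i6 i7 card_augmented /MG take_size.
have pn : p <= n by rewrite -pq leq_addr.
have frame mu' k : (forall z, z != 8 -> mu' z = mu z) -> forall x, mu' (slot k x) = mu (slot k x).
  by move=> h x; rewrite h // slot_cell.
case: ifP evc => _ evc.
  have [|k [st [r l o]]] := @exec_emit_all emit_augmented (emitted (augmented i j pi)) mu [::] i2 i8.
    move=> mu' out' x xp hz h8; apply: runs_emit_augmented => //.
    - by apply: stores_eq s0; exact: frame.
    - by apply: stores_eq s1; exact: frame.
    - by apply: stores_eq s2; exact: frame.
  exists (cost (Bin Ltb (cell 6) (cell 7)) + k).+1, st; split=> //.
    exact: (exec_if (st := State mu [::]) evc r).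
  by nia.
have [|k [st [r l o]]] := @exec_emit_all emit_greedy (emitted (greedy pi)) mu [::] i2 i8.
  move=> mu' out' x xp hz h8; apply: runs_emit_greedy => //.
  by apply: stores_eq sG; exact: frame.
exists (cost (Bin Ltb (cell 6) (cell 7)) + k).+1, st; split=> //.
  exact: (exec_if (st := State mu [::]) evc r).
by nia.
Qed.

End Stream.
End Side.
End Machine.

(** * Word size, memory and the complete run *)

Lemma leq_muln_div x y m : x <= y -> 0 < y -> (x * m) %/ y <= m.
Proof. by move=> xy y0; rewrite -{2}(mulKn m y0) leq_div2r // leq_mul2r xy orbT. Qed.

Lemma cuts_le m : first_cut m <= second_cut m <= m.
Proof.
rewrite /first_cut /second_cut (leq_muln_div _ (isT : 7595 <= 10000)) // andbT.
by apply: leq_div2r; rewrite leq_mul2r orbT.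
Qed.

(** The product [x * m] may exceed [bd], so the general evaluation rules do not cover it and the
    word size enters directly. *)
Lemma eval_cut w S mu x y m : x < 2 ^ w -> y < 2 ^ w -> x * m < 2 ^ w -> 4 < S -> mu 4 = m ->
  4 < 2 ^ w -> eval w S mu (Bin Div (Bin Mul (Cst x) (cell 4)) (Cst y)) = Some ((x * m) %/ y).
Proof.
move=> hx hy hxm hS m4 h4; rewrite /= (modn_small h4) hS m4 (modn_small hx) (modn_small hy).
by rewrite (modn_small hxm) modn_small // (leq_ltn_trans (leq_div _ _)).
Qed.

Definition stream_program := Program stream_init stream_body stream_finish.

Definition stream_constant :=
  64 + time_bound stream_init + time_bound stream_body +
  (cost (Bin Ltb (cell 6) (cell 7)) + 1 + loop_bound emit_augmented + loop_bound emit_greedy).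

(** [n.+1] is at most [2 ^ bitlen n], [n.+1 * n.+1] dominates the number of edges, and [2 ^ 14]
    exceeds the constants of the phase ends. *)
Lemma word_large n c : 64 <= c -> 2 ^ 14 * (n.+1 * n.+1) <= 2 ^ (c * bitlen n).
Proof.
move=> hc; have hn : n.+1 <= 2 ^ bitlen n by rewrite /bitlen trunc_log_ltn.
have b1 : 0 < bitlen n by [].
apply: leq_trans (_ : 2 ^ 14 * (2 ^ bitlen n * 2 ^ bitlen n) <= _).
  by rewrite leq_mul2l leq_mul ?orbT.
by rewrite -!expnD leq_exp2l //; nia.
Qed.

Section Program.
Variables (p q : nat) (pi : seq ('I_p * 'I_q)) (w S : nat).
Local Notation n := (p + q).
Local Notation m := (size pi).
Hypotheses (mn : m <= n * n) (hw : 2 ^ 14 * (n.+1 * n.+1) <= 2 ^ w) (hS : 24 + 8 * n <= S).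
Local Notation bd := (24 + 8 * n + m).

Lemma bd_lt : bd < 2 ^ w.
Proof.
clear hS; apply: leq_trans hw; have -> : 2 ^ 14 = 8192 + 8192 by [].
(* Only [25 <= K] matters; abstracting the numeral keeps it away from [nia]. *)
by move: (8192) (isT : 25 <= 8192) => K hK; nia.
Qed.

Lemma exec_stream_init : exists k mu,
  [/\ exec w S stream_init (start_state w p q m) k (State mu [::]), k <= time_bound stream_init
    & stream_invariant (first_cut m) (second_cut m) pi mu 0].
Proof.
have hbd := bd_lt; have [/andP[ij jm]] := (cuts_le m).
have upE mu x v z : v <= bd -> upd w mu x v z = if z == x then v else mu z.
  exact: updE.
rewrite /start_state.
set mu0 := upd w (upd w _ _ _) 4 m.
have e0 z : mu0 z = if z == 4 then m else if z == 3 then q else if z == 2 then p else 0.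
  by rewrite /mu0 !upE //; lia.
pose mu1 := upd w mu0 9 (first_cut m); pose mu2 := upd w mu1 10 (second_cut m).
have e1 z : mu1 z = if z == 9 then first_cut m else mu0 z by rewrite /mu1 upE //; lia.
have e2 z : mu2 z = if z == 10 then second_cut m else mu1 z by rewrite /mu2 upE //; lia.
have small x : x < 2 ^ 14 -> x < 2 ^ w /\ x * m < 2 ^ w.
  move=> hx; split; apply: leq_trans hw.
    by apply: leq_trans hx _; rewrite leq_pmulr.
  by apply: leq_ltn_trans (_ : x * (n.+1 * n.+1) < _); [nia | rewrite ltn_pmul2r].
have [s1 s1'] := small 4312 isT; have [s2 s2'] := small 7595 isT; have [s3 _] := small 10000 isT.
have c4 : 4 < 2 ^ w by apply: leq_ltn_trans hbd; lia.
have S4 : 4 < S by lia.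
have [k1 r1 l1] : runs w S (Store (Cst 9) (Bin Div (Bin Mul (Cst 4312) (cell 4)) (Cst 10000)))
    (State mu0 [::]) (State mu1 [::]).
  apply: runs_store; [apply: (ev_cst S hbd); lia | lia |].
  exact: eval_cut s1 s3 s1' S4 (e0 4) c4.
have [k2 r2 l2] : runs w S (Store (Cst 10) (Bin Div (Bin Mul (Cst 7595) (cell 4)) (Cst 10000)))
    (State mu1 [::]) (State mu2 [::]).
  apply: runs_store; [apply: (ev_cst S hbd); lia | lia |].
  by apply: (eval_cut s2 s3 s2' S4 _ c4); rewrite e1 e0.
exists (k1 + k2), mu2; split; first exact: exec_seq r1 r2.
  exact: leq_add.
have z0 k x : mu2 (slot k x) = 0 by rewrite e2 e1 e0 !slot_cell.
have sto kA kB (M : {set 'I_p * 'I_q}) : M = set0 -> stores mu2 kA kB M.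
  by move=> ->; split=> x; rewrite z0 ?mateA_set0 ?mateB_set0.
have EG : MG pi 0 = set0 by rewrite /MG take0.
have E0 : M0 (first_cut m) pi 0 = set0 by rewrite /M0 min0n /phase0 take0.
have E1 : M1 (first_cut m) (second_cut m) pi 0 = set0 by rewrite /M1 min0n take0.
have E2 : M2 (first_cut m) (second_cut m) pi 0 = set0 by rewrite /M2 take0.
split; last split.
- by split; rewrite e2 // e1 // e0.
- by rewrite EG E0 E1 E2 cards0; split; rewrite e2 e1 e0.
- by split; apply: sto.
Qed.

End Program.

Lemma stream_program_semi_streaming :
  one_pass_semi_streaming (fun _ : nat => 1%N)
    (fun p q : nat => @random_order_matching 'I_p 'I_q).
Proof.
exists stream_program, stream_constant => p q E pi hpi /=.
have sz := ordering_size hpi; set c := stream_constant.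
have c64 : 64 <= c by rewrite /c /stream_constant; lia.
set n := p + q; set w := c * _; set S := c * _.
have hw : 2 ^ 14 * (n.+1 * n.+1) <= 2 ^ w by exact: word_large.
have hS : 24 + 8 * n <= S.
  have : 0 < bitlen n ^ c by rewrite expn_gt0.
  by rewrite /S; move: (bitlen n ^ c) => b b0; nia.
have mn : size pi <= n * n.
  rewrite sz; apply: leq_trans (max_card _) _; rewrite card_prod !card_ord /n; nia.
have hbd := bd_lt mn hw.
have [/andP[ij jm]] := cuts_le (size pi).
have nbd : 24 + 8 * n <= 24 + 8 * n + size pi by rewrite leq_addr.
have szbd : size pi < 24 + 8 * n + size pi by lia.
have [k1 [mu1 [r1 l1 inv1]]] := exec_stream_init mn hw hS.
have [mu2 r2 inv2] := runs_stream hbd hS nbd (erefl n) szbd ij jm [::] (leq0n _) inv1.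
have [k3 [st [r3 l3 o3]]] := exec_stream_finish hbd hS nbd (erefl n) szbd ij jm inv2.
exists (out_of st); split.
  exists k1, (State mu1 [::]), (State mu2 [::]), k3, st; rewrite -sz; split=> //.
  - split=> //; apply: leq_trans l1 _; rewrite /c /stream_constant; nia.
  - rewrite drop0 in r2; rewrite muln1.
    have : time_bound stream_body <= c by rewrite /c /stream_constant; lia.
    (* [pass] is monotone in its time bound, here raised from that of the body to the constant
       [c]. *)
    move: r2; move: (time_bound _) => tb r2 le; elim: r2 => [st'|st' e s k st1 st2 h hk _ IH].
      by constructor.
    exact: pass_cons h (leq_trans hk le) IH.
  - split=> //; apply: leq_trans l3 _; rewrite mulnC leq_mul2r; apply/orP; right.
    by rewrite /c /stream_constant; lia.
have /andP[_] := random_order_matching_of hpi.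
by rewrite o3 -sz (random_order_matchingE (erefl (size pi))); exact: emitted_enum.
Qed.

Theorem theorem1 :
  one_pass_semi_streaming (fun _ : nat => 1%N)
    (fun p q : nat => @random_order_matching 'I_p 'I_q)
  /\
  (forall (A B : finType) (E Mstar : {set A * B}),
     maximum_matching_of E Mstar ->
     (forall pi : seq (A * B), ordering_of E pi ->
        matching_of E (random_order_matching #|E| pi)) /\
     ((1 / 2%:R + 5%:R / 1000%:R) * (#|Mstar|)%:R
        <= expectation_over_orderings E
             (fun pi => (#|random_order_matching #|E| pi|)%:R :> rat))%R).
Proof.
split; first exact: stream_program_semi_streaming.
move=> A B E Mstar [/andP[sM mM] _]; split; first exact: random_order_matching_of.
exact: random_order_ratio.
Qed.
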